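(* Let $k=1$ if all $B_{i,j}=0$ and $k=2$ otherwise. Let $y(\cdot)\in W^{k,\infty}(\Omega^{\mathsf o};\mathbf Y)\cap C(\Omega;\mathbf Y)$ satisfy $$F(x,y(x),\mathcal D y(x))+\sum_{i\le j}B_{i,j}(x,y(x))\frac{\partial^2 y}{\partial x_i\partial x_j}(x)=0\quad\text{for Lebesgue-a.e. }x\in\Omega^{\mathsf o},$$ $$G(x,y(x),\mathcal D y(x))=0\quad\text{for }\sigma\text{-a.e. }x\in\partial\Omega .$$ Let $\mu$ and $\mu_\partial$ be the occupation and boundary measures of $y(\cdot)$, i.e. the Borel measures on $\Omega\times\mathbf Y\times\mathbf Z$ and $\partial\Omega\times\mathbf Y\times\mathbf Z$ given by $$\mu(A\times B\times C)=\int_\Omega \mathbb I_{A\times B\times C}(x,y(x),\mathcal D y(x))\,dx,\qquad \mu_\partial(A\times B\times C)=\int_{\partial\Omega}\mathbb I_{A\times B\times C}(x,y(x),\mathcal D y(x))\,d\sigma(x)$$ for Borel $A\subset\Omega$ (respectively $A\subset\partial\Omega$), $B\subset\mathbf Y$, $C\subset\mathbf Z$. Then for all $\phi\in C^\infty(\Omega\times\mathbf Y)$: (a) for all $m\in\{1,\dots,n\}$, $$\int_{\Omega\times\mathbf Y\times\mathbf Z}\Big[\frac{\partial\phi}{\partial x_m}+\sum_{l=1}^{n_y}\frac{\partial\phi}{\partial y_l}z_{l,m}\Big]d\mu(x,y,z)-\int_{\partial\Omega\times\mathbf Y\times\mathbf Z}\phi(x,y)\,\eta_m(x)\,d\mu_\partial(x,y,z)=0;$$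 (b) $$\int_{\Omega\times\mathbf Y\times\mathbf Z}\phi(x,y)F(x,y,z)\,d\mu-\sum_{i\le j}\int_{\Omega\times\mathbf Y\times\mathbf Z}\phi(x,y)\Big[\frac{\partial B_{i,j}}{\partial x_j}+\sum_{l=1}^{n_y}\frac{\partial B_{i,j}}{\partial y_l}z_{l,j}\Big]z_{\bullet,i}\,d\mu$$ $$-\sum_{i\le j}\int_{\Omega\times\mathbf Y\times\mathbf Z}\Big[\frac{\partial\phi}{\partial x_j}+\sum_{l=1}^{n_y}\frac{\partial\phi}{\partial y_l}z_{l,j}\Big]B_{i,j}(x,y)z_{\bullet,i}\,d\mu+\sum_{i\le j}\int_{\partial\Omega\times\mathbf Y\times\mathbf Z}B_{i,j}(x,y)\phi(x,y)z_{\bullet,i}\,\eta_j(x)\,d\mu_\partial=0;$$ (c) $$\int_{\partial\Omega\times\mathbf Y\times\mathbf Z}\phi(x,y)G(x,y,z)\,d\mu_\partial(x,y,z)=0.$$ Here $z_{\bullet,i}$ denotes the $i$-th column of the matrix variable $z\in\mathbb R^{n_y\times n}$.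
   Context: **Domain.** $\Omega=\{x\in\mathbb R^n\mid g^\Omega_i(x)\ge 0,\ i=1,\dots,n^\Omega\}$ is a compact basic semialgebraic set ($g_i^\Omega$ polynomials), equal to the closure of its interior $\Omega^{\mathsf o}$, with (locally) Lipschitz boundary $\partial\Omega$. $\sigma$ is the surface measure on $\partial\Omega$ and $\eta=(\eta_1,\dots,\eta_n)$ the outward unit normal, so that $\int_{\partial\Omega}h\,\eta_m\,d\sigma=\int_\Omega\frac{\partial h}{\partial x_m}\,dx$ for all $h\in W^{1,\infty}(\Omega^{\mathsf o})$, $m=1,\dots,n$. The boundary is decomposed as $\partial\Omega=\bigcup_{i=1}^{n_{\mathrm b}}\partial\Omega_i$ with each $\partial\Omega_i$ basic semialgebraic and smooth, pairwise disjoint up to $\sigma$-null sets. **Data.** $F:\mathbb R^n\times\mathbb R^{n_y}\times\mathbb R^{n_y\times n}\to\mathbb R^{n_F}$ is a polynomial map; $B_{i,j}:\mathbb R^n\times\mathbb R^{n_y}\to\mathbb R^{n_F\times n_y}$ ($1\le i\le j\le n$) are matrix functions with polynomial entries; $G:\mathbb R^n\times\mathbb R^{n_y}\times\mathbb R^{n_y\times n}\to\mathbb R^{n_G}$ is piecewise polynomial: for $x\in\partial\Omega_i$ it coincides with a polynomial map. **Notation.** $\mathcal D y$ is the (weak) Jacobian, $(\mathcal D y)_{l,m}=\partial y_l/\partial x_m$, and $\frac{\partial^2y}{\partial x_i\partial x_j}=[\frac{\partial^2y_1}{\partial x_i\partial x_j},\dots,\frac{\partial^2y_{n_y}}{\partial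 x_i\partial x_j}]^\top$. $\mathbf Y\subset\mathbb R^{n_y}$ and $\mathbf Z\subset\mathbb R^{n_y\times n}$ are Borel sets such that $y(x)\in\mathbf Y$ and $\mathcal D y(x)\in\mathbf Z$ (Lebesgue-a.e. in $\Omega$ and $\sigma$-a.e. on $\partial\Omega$). When $k=2$, $\mathcal D y$ on $\partial\Omega$ is the trace (continuous extension) of $\mathcal D y$; when $k=1$, $\mathcal D y|_{\partial\Omega}$ denotes a fixed bounded $\sigma$-measurable function used both in the boundary condition and in the definition of $\mu_\partial$. $C^\infty(\Omega\times\mathbf Y)$ denotes restrictions to $\Omega\times\mathbf Y$ of $C^\infty$ functions on $\mathbb R^n\times\mathbb R^{n_y}$. $\mathbb I_S$ is the indicator function of $S$. *)

(* Defs.v *)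
From HB Require Import structures.
From mathcomp Require Import all_boot all_order all_algebra.
From mathcomp Require Import all_classical all_reals all_analysis.
From mathcomp Require Import measurable_realfun.
(* Not imported: the notations of mpoly clash with those of analysis. *)
From mathcomp Require mpoly.
Set Implicit Arguments.
Unset Strict Implicit.
Unset Printing Implicit Defensive.
Import Order.TTheory GRing.Theory Num.Theory.
Import numFieldNormedType.Exports.
Local Open Scope classical_set_scope.
Local Open Scope ring_scope.

(* Points of R^n are row vectors, values of maps into R^p are column vectors;
   both are matrices and carry the Borel sigma-algebra of their topology. *)
Section matrix_borel.
Variables (R : realType) (m n : nat).

Definition mx_borel : set (set 'M[R]_(m, n)) := <<s open >>.

Let mx_borel0 : mx_borel set0.
Proof. exact: sigma_algebra0. Qed.

Let mx_borelC A : mx_borel A -> mx_borel (~` A).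
Proof. exact: sigma_algebraC. Qed.

Let mx_borel_bigcup (F : (set 'M[R]_(m, n))^nat) :
  (forall i, mx_borel (F i)) -> mx_borel (\bigcup_i F i).
Proof. exact: sigma_algebra_bigcup. Qed.

HB.instance Definition _ := @isMeasurable.Build default_measure_display
  'M[R]_(m, n) mx_borel mx_borel0 mx_borelC mx_borel_bigcup.

End matrix_borel.

Lemma measurable_fun_mx (R : realType) (m n : nat) d (T : measurableType d)
    (D : set T) (f : T -> 'M[R]_(m, n)) :
  (forall i j, measurable_fun D (fun x => f x i j)) -> measurable_fun D f.
Proof.
move=> mf mD; move: (mD); apply: (measurability (@open 'M[R]_(m, n))) => //.
move=> _ [U oU <-].
pose rat_ball (q : 'M[rat]_(m, n)) (k : nat) :=
  [set A : 'M[R]_(m, n) | forall i j, ball (ratr (q i j) : R) k.+1%:R^-1 (A i j)].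
pose V (p : 'M[rat]_(m, n) * nat) :=
  if `[< rat_ball p.1 p.2 `<=` U >] then rat_ball p.1 p.2 else set0.
suff -> : U = \bigcup_p V p.
  rewrite preimage_bigcup setI_bigcupr.
  apply: countable_bigcupT_measurable; first exact: countableP.
  move=> p; rewrite /V; case: asboolP => _; last by rewrite preimage_set0 setI0.
  rewrite (_ : _ `&` _ = D `&` \bigcap_(ij in [set: 'I_m * 'I_n])
      (D `&` (fun x => f x ij.1 ij.2) @^-1`
        ball (ratr (p.1 ij.1 ij.2) : R) p.2.+1%:R^-1)); last first.
    apply/seteqP; split=> x [Dx px]; split=> //.
      by move=> [i j] _; split=> //; exact: px.
    by move=> i j; have [] := px (i, j) I.
  apply: measurableI => //; apply: fin_bigcap_measurable => //.
  by move=> ij _; apply: mf => //; rewrite ball_itv; exact: measurable_itv.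
apply/seteqP; split=> [A UA|A [p _]]; last first.
  by rewrite /V; case: asboolP => // pU /pU.
have /nbhs_ballP[e /= e0 eU] : nbhs A U by exact: open_nbhs_nbhs.
have e20 : 0 < e / 2 by rewrite divr_gt0.
have [k ke] : exists k, k.+1%:R^-1 < e / 2 :> R.
  exists (Num.truncn (e / 2)^-1).
  rewrite invf_plt ?posrE ?ltr0n//; exact: truncnS_gt.
have k0 : 0 < k.+1%:R^-1 :> R by rewrite invr_gt0 ltr0n.
have qP i j : exists q : rat, ball (ratr q : R) k.+1%:R^-1 (A i j).
  have [|q] := @rat_in_itvoo R (A i j - k.+1%:R^-1) (A i j + k.+1%:R^-1).
    by rewrite ltrD2l gtrN.
  rewrite in_itv/= => /andP[q1 q2]; exists q.
  by rewrite /ball/= ltr_distl q1 q2.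
pose q := \matrix_(i < m, j < n) projT1 (cid (qP i j)).
have qA : rat_ball q k A by move=> i j; rewrite /q mxE; case: cid.
exists (q, k) => //; rewrite /V; case: asboolP => // -[] B qB /=.
apply: eU; split=> // i j; rewrite (splitr e).
have Aq : ball (A i j) (e / 2) (ratr (q i j) : R).
  by apply: ball_sym; apply: le_ball (qA i j); exact: ltW.
apply: ball_triangle Aq _; apply: le_ball (qB i j); exact: ltW.
Qed.

Lemma measurable_coord (R : realType) (m n : nat) (i : 'I_m) (j : 'I_n) :
  measurable_fun setT (fun A : 'M[R]_(m, n) => A i j).
Proof.
move=> mT; move: (mT); apply: (measurability _ (RGenOpens.measurableE R)).
move=> _ [_ [a [b ->]] <-]; rewrite setTI; apply: sub_sigma_algebra.
apply: open_comp; last exact: interval_open.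
by move=> A _; exact: coord_continuous.
Qed.

Section lebesgue_measure_rV.
Variable R : realType.

Definition cons_rV n (p : 'rV[R]_n * measurableTypeR R) : 'rV[R]_n.+1 :=
  row_mx (p.2 : R)%:M p.1.

Fixpoint lebesgue_rV n : set 'rV[R]_n -> \bar R :=
  if n isn't n'.+1 then \d_(0 : 'rV[R]_0)
  else pushforward (@lebesgue_rV n' \x @lebesgue_measure R)%E (@cons_rV n').

Lemma cons_rV0 n (p : 'rV[R]_n * measurableTypeR R) : cons_rV p 0 0 = p.2.
Proof.
rewrite /cons_rV (_ : 0 = lshift n (0 : 'I_1)); last exact/val_inj.
by rewrite [LHS]row_mxEl mxE eqxx.
Qed.

Lemma cons_rVS n (p : 'rV[R]_n * measurableTypeR R) i :
  cons_rV p 0 (lift ord0 i) = p.1 0 i.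
Proof.
rewrite /cons_rV (_ : lift ord0 i = rshift 1 i); last exact/val_inj.
exact: row_mxEr.
Qed.

Lemma measurable_cons_rV n : measurable_fun setT (@cons_rV n).
Proof.
apply: measurable_fun_mx => i j; rewrite ord1.
have [k ->|->] := unliftP ord0 j.
  rewrite [X in measurable_fun _ X](_ : _ =
      (fun A : 'rV[R]_n => A 0 k) \o fst).
    by apply: measurableT_comp; [exact: measurable_coord|exact: measurable_fst].
  by apply/funext => p; exact: cons_rVS.
rewrite [X in measurable_fun _ X](_ : _ = snd); first exact: measurable_snd.
by apply/funext => p; exact: cons_rV0.
Qed.

Let lebesgue_rV_measure n :
  exists mu : {measure set 'rV[R]_n -> \bar R}, mu = @lebesgue_rV n :> (_ -> _).
Proof.
elim: n => [|n [mu muE]]; first by exists (dirac (0 : 'rV[R]_0)).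
exists (measure_function_pushforward__canonical__measure_function_Measure
  (mu \x @lebesgue_measure R)%E (@measurable_cons_rV n)).
by rewrite /= -muE.
Qed.

Section instance.
Variable n : nat.

Let lebesgue_rV0 : @lebesgue_rV n set0 = 0%E.
Proof. by have [mu <-] := lebesgue_rV_measure n; exact: measure0. Qed.

Let lebesgue_rV_ge0 A : (0 <= @lebesgue_rV n A)%E.
Proof. by have [mu <-] := lebesgue_rV_measure n; exact: measure_ge0. Qed.

Let lebesgue_rV_sigma_additive : semi_sigma_additive (@lebesgue_rV n).
Proof.
by have [mu <-] := lebesgue_rV_measure n; exact: measure_semi_sigma_additive.
Qed.

HB.instance Definition _ := isMeasure.Build _ _ _ (@lebesgue_rV n)
  lebesgue_rV0 lebesgue_rV_ge0 lebesgue_rV_sigma_additive.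

End instance.

Lemma measurable_box n (a b : 'rV[R]_n) :
  measurable [set x : 'rV[R]_n | forall i, a 0 i <= x 0 i <= b 0 i].
Proof.
rewrite (_ : mkset _ = \bigcap_(i in [set: 'I_n])
    ((fun x : 'rV[R]_n => x 0 i) @^-1` `[a 0 i, b 0 i])); last first.
  apply/seteqP; split=> x ax i => [_|]; first by rewrite /= in_itv/=; exact: ax.
  by have := ax i Logic.I; rewrite /= in_itv.
apply: fin_bigcap_measurable => // i _; rewrite -[X in measurable X]setTI.
by apply: measurable_coord => //; exact: measurable_itv.
Qed.

Lemma lebesgue_rV_box n (a b : 'rV[R]_n) : (forall i, a 0 i <= b 0 i) ->
  lebesgue_rV [set x | forall i, a 0 i <= x 0 i <= b 0 i] =
  (\prod_i (b 0 i - a 0 i))%:E.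
Proof.
elim: n => [|n IH] in a b * => ab.
  by rewrite big_ord0 /= diracE mem_set// => -[].
pose tl (x : 'rV[R]_n.+1) : 'rV[R]_n := rsubmx (x : 'rV_(1 + n)).
have tlE x i : tl x 0 i = x 0 (lift ord0 i).
  by rewrite mxE; congr (x _ _); apply/val_inj.
have mE : lebesgue_measure (`[a 0 0, b 0 0]%classic : set R) =
    (b 0 0 - a 0 0)%:E.
  by rewrite lebesgue_measure_itv/= lte_fin EFinB; case: ltgtP (ab 0) => // ->;
    rewrite subee.
rewrite big_ord_recl mulrC EFinM -mE -(eq_bigr _ (fun i _ => congr2 _ (tlE b i)
  (congr1 -%R (tlE a i)))) -IH; last by move=> i; rewrite !tlE.
have [mu muE] := lebesgue_rV_measure n.
rewrite -muE /= -muE -product_measure1E; last 2 first.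
- exact: measurable_box.
- exact: measurable_itv.
rewrite /pushforward; congr (_ _); apply/seteqP; split=> -[x t]/=.
  move=> abx; split=> [i|]; first by have := abx (lift ord0 i); rewrite !tlE cons_rVS.
  by have := abx 0; rewrite in_itv/= cons_rV0.
rewrite in_itv/= => -[abx abt] i; have [j ->|->] := unliftP ord0 i.
  by rewrite cons_rVS -!tlE; exact: abx.
by rewrite cons_rV0.
Qed.

End lebesgue_measure_rV.

Section euclidean.
Variables (R : realType) (n : nat).
Implicit Types (x y v : 'rV[R]_n) (A E Omega : set 'rV[R]_n).

Definition dot x y : R := \sum_i x 0 i * y 0 i.

(* The library norm on matrices is the sup norm. *)
Definition enorm x : R := Num.sqrt (dot x x).

Definition boundary A := closure A `\` A°.

Definition ediam E : R := sup [set enorm (x - y) | x in E & y in E].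

Definition lipschitz_boundary Omega :=
  forall x, boundary Omega x ->
  exists (Q : 'M[R]_n) (i : 'I_n) (gamma : 'rV[R]_n.-1 -> R) (L : R)
    (U : set 'rV[R]_n),
  [/\ Q *m Q^T = 1%:M,
      forall s t, `|gamma s - gamma t| <= L * `|s - t|,
      open U, U x
    & forall z, U z -> Omega z <-> gamma (col' i (z *m Q)) <= (z *m Q) 0 i].

(* Omega is tangent at x to the half-space {z | dot (z - x) v <= 0}; at a point
   where the boundary is locally a graph, this says that the graph is
   differentiable there and that v is its unit normal pointing out of Omega. *)
Definition outward_unit_normal Omega x v :=
  dot v v = 1 /\ forall e : R, 0 < e -> \forall z \near x,
    (e * enorm (z - x) < dot (z - x) v -> ~ Omega z) /\
    (dot (z - x) v < - (e * enorm (z - x)) -> Omega z).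

End euclidean.

Section hausdorff_measure.
Variables (R : realType) (n : nat).
Implicit Types A E : set 'rV[R]_n.

Definition unit_ball_volume (s : nat) : R :=
  fine (lebesgue_rV [set v : 'rV[R]_s | enorm v <= 1]).

(* 0 ^+ 0 = 1, so for s = 0 this is 1 on singletons. *)
Definition hausdorff_gauge (s : nat) E : R :=
  if `[< E !=set0 >] then unit_ball_volume s * (ediam E / 2) ^+ s else 0.

Definition hausdorff_cover (delta : R) A (E : (set 'rV[R]_n)^nat) :=
  A `<=` \bigcup_k E k /\
  forall k x y, E k x -> E k y -> enorm (x - y) <= delta.

Definition hausdorff_premeasure (s : nat) (delta : R) A : \bar R :=
  ereal_inf [set (\sum_(0 <= k <oo) (hausdorff_gauge s (E k))%:E)%E |
              E in hausdorff_cover delta A].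

(* Normalized so that it is the s-dimensional area on s-dimensional
   Lipschitz surfaces. *)
Definition hausdorff_measure (s : nat) A : \bar R :=
  ereal_sup [set hausdorff_premeasure s delta A | delta in [set e | 0 < e]].

End hausdorff_measure.

(* mu-measurability of f on D, i.e. measurability for the completion of mu. *)
Definition measurable_fun_completion (R : realType) d d' (T : measurableType d)
    (T' : measurableType d') (mu : {measure set T -> \bar R}) (D : set T)
    (f : T -> T') :=
  exists2 g : T -> T', measurable_fun D g
    & {ae mu, forall x, D x -> f x = g x}.

Section smooth.
Variables (R : realType) (V : normedModType R).

Fixpoint iter_derive (s : seq V) (f : V -> R^o) : V -> R^o :=
  if s is v :: s' then 'D_v (iter_derive s' f) else f.

(* C^oo on the finite-dimensional space V *)
Definition smooth (f : V -> R^o) :=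
  forall s x, differentiable (iter_derive s f) x.

Definition test_function (U : set V) (psi : V -> R^o) :=
  smooth psi /\
  exists K, [/\ compact K, K `<=` U & forall x, ~ K x -> psi x = 0].

End smooth.

Section sobolev.
Variables (R : realType) (n : nat).
Implicit Types (U : set 'rV[R]_n) (u g : 'rV[R]_n -> R).

Definition Linfty U u :=
  measurable_fun_completion (@lebesgue_rV R n) U u /\
  exists M, {ae @lebesgue_rV R n, forall x, U x -> `|u x| <= M}.

(* g is the distributional derivative of u in direction m on the open set U;
   only meaningful for locally integrable u and g. *)
Definition weak_partial U (m : 'I_n) u g :=
  forall psi : 'rV[R]_n -> R, test_function U psi ->
  \int[@lebesgue_rV R n]_(x in U) (u x * 'D_(delta_mx 0 m) (psi : _ -> R^o) x) =
  - \int[@lebesgue_rV R n]_(x in U) (g x * psi x).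

(* u belongs to W^(k,oo)(U) *)
Fixpoint sobolev_infty U (k : nat) u : Prop :=
  Linfty U u /\
  if k is k'.+1 then
    forall m, exists2 g, weak_partial U m u g & sobolev_infty U k' g
  else True.

End sobolev.

Section semialgebraic.
Variables (R : realType) (n : nat).

Definition basic_semialgebraic N (g : 'I_N -> mpoly.mpoly n R) :
    set 'rV[R]_n :=
  [set x | forall i, 0 <= mpoly.meval (x 0) (g i)].

(* S is locally a piece of a C^oo hypersurface; such pieces may have edges. *)
Definition smooth_piece (S : set 'rV[R]_n) :=
  forall x, S x -> exists (U : set 'rV[R]_n) (rho : 'rV[R]_n -> R^o),
  [/\ open U, U x, smooth rho, exists v, 'D_v rho x != 0
    & forall z, U z -> S z -> rho z = 0].

End semialgebraic.

(* sigma is the surface measure and eta the outward unit normal of boundary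
   Omega, satisfying the divergence theorem. Over a domain with Lipschitz
   boundary each class in W^(1,oo) has a representative continuous up to the
   boundary, and this representative h provides the boundary values. *)
Record surface_data (R : realType) (n : nat) (Omega : set 'rV[R]_n)
    (sigma : {finite_measure set 'rV[R]_n -> \bar R})
    (eta : 'rV[R]_n -> 'rV[R]_n) : Prop := {
  surface_measureE : forall A, measurable A ->
    sigma A = hausdorff_measure n.-1 (A `&` boundary Omega) ;
  surface_normal : {ae sigma, forall x, boundary Omega x ->
    outward_unit_normal Omega x (eta x)} ;
  surface_normal_measurable : measurable_fun_completion sigma (boundary Omega) eta ;
  gauss_green : forall (m : 'I_n) (h dh : 'rV[R]_n -> R),
    {within Omega, continuous h} ->
    sobolev_infty Omega° 1 h ->
    weak_partial Omega° m h dh -> Linfty Omega° dh ->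
    \int[sigma]_(x in boundary Omega) (h x * eta x 0 m) =
    \int[@lebesgue_rV R n]_(x in Omega) dh x }.

Section jets.
Variables (R : realType) (n p : nat).

Definition xy_coords (w : 'rV[R]_n * 'cV[R]_p) : 'rV[R]_(n + p) :=
  row_mx w.1 w.2^T.

Definition jet_coords (w : 'rV[R]_n * 'cV[R]_p * 'M[R]_(p, n)) :
    'rV[R]_(n + p + p * n) :=
  row_mx (xy_coords w.1) (mxvec w.2).

Definition polynomial_in (T : Type) N (coords : T -> 'rV[R]_N) (f : T -> R) :=
  exists P : mpoly.mpoly N R, forall w, f w = mpoly.meval (coords w 0) P.

End jets.

Section calculus.
Variables (R : realType) (n p : nat).
Local Notation XY := ('rV[R]_n * 'cV[R]_p)%type.
Local Notation jet := ('rV[R]_n * 'cV[R]_p * 'M[R]_(p, n))%type.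

(* df/dx_m + sum_l df/dy_l z_(l,m) at w = (x, y, z) *)
Definition total_derivative (V : normedModType R) (f : XY -> V) (m : 'I_n)
    (w : jet) : V :=
  'D_((delta_mx 0 m, 0) : XY) f w.1 +
  \sum_(l < p) w.2 l m *: 'D_((0, delta_mx l 0) : XY) f w.1.

(* nu is the image of mu restricted to D under x |-> (x, y(x), Dy(x)). *)
Definition is_occupation_measure (mu : {measure set 'rV[R]_n -> \bar R})
    (D : set 'rV[R]_n) (y : 'rV[R]_n -> 'cV[R]_p)
    (Dy : 'rV[R]_n -> 'M[R]_(p, n)) (Y : set 'cV[R]_p) (Z : set 'M[R]_(p, n))
    (nu : {measure set jet -> \bar R}) :=
  forall A B C, measurable A -> A `<=` D -> measurable B -> B `<=` Y ->
  measurable C -> C `<=` Z ->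
  nu (A `*` B `*` C) =
  (\int[mu]_(x in D) (\1_(A `*` B `*` C) (x, y x, Dy x))%:E)%E.

End calculus.

Definition mx_integral (R : realType) d (T : measurableType d)
    (mu : {measure set T -> \bar R}) (D : set T) a b (f : T -> 'M[R]_(a, b)) :=
  \matrix_(i < a, j < b) \int[mu]_(w in D) f w i j.

(* Main.v *)
Require Import Defs.
From HB Require Import structures.
From mathcomp Require Import all_boot all_order all_algebra.
From mathcomp Require Import all_classical all_reals all_analysis.
From mathcomp Require Import measurable_realfun ring lra.
From mathcomp Require mpoly.
Import Order.TTheory GRing.Theory Num.Theory.
Import numFieldNormedType.Exports.
Set Implicit Arguments.
Unset Strict Implicit.
Unset Printing Implicit Defensive.
Local Open Scope classical_set_scope.
Local Open Scope ring_scope.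

(* Along the graph of y the measures mu and mub turn (a) and (b) into the
   divergence theorem for h = phi(x, y(x)) and h = phi(x, y(x)) B(x, y(x)) Dy(x),
   so that everything rests on the chain rule for weak derivatives of bounded
   continuous functions. It is proved without mollifiers. Let v be continuous with
   weak derivative g in direction e, |g| <= M, and let psi be a test function.
   Translating psi along e and differentiating under the integral gives
   |int (v(x + te) - v(x)) psi| <= t M int |psi| and
   t^-1 int (v(x + te) - v(x)) psi -> int g psi. Both statements pass from psi to
   psi c for continuous c, since on the support of psi the function c is a
   uniform limit of smooth functions P and psi P is again a test function.
   A first order expansion of f(u(x + te)) - f(u(x)) then yields the chain rule. *)

(** * Smooth functions *)

(** The weights [c] that occur are the derivatives of [f] at [u(x)]; they are no smoother than [u],
    hence the passage from smooth to continuous weights. The remainder of the expansion is at most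
    eps times the sum of the [|u_i(x + te) - u_i(x)|], so division by t requires an L1 bound of
    order t on the increments; it comes from testing an increment against a continuous approximation
    of its own sign. Translations leave Omega and the data are given only on Omega and almost
    everywhere, so y is replaced by a continuous extension to the whole space and Dy by a bounded
    Borel function. This representative says nothing sigma-almost everywhere, so boundary integrals
    keep Dy itself. Integrals run over Omega while weak derivatives and the equation live on its
    interior; the gap closes because the boundary is Lebesgue-null. In (b) the factor Dy is
    differentiated too. A column of Dy is treated as one more continuous unknown [c] with weak
    derivative D2y, and the chain rule is applied to a function of (x, y, c) that is linear in [c];
    this replaces a product rule for weak derivatives. *)

Section smooth_theory.
Variables (R : realType) (V : normedModType R).
Implicit Types f g : V -> R^o.

(** Smoothness is graded by order because a derivative of a product is a sum of products: the
    induction must run over the order for all functions at once. It peels off the innermost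
    derivative, the last entry of the list. *)
Definition smooth_upto k f :=
  forall s x, (size s <= k)%N -> differentiable (iter_derive s f) x.

Lemma iter_derive_rcons s v f :
  iter_derive (rcons s v) f = iter_derive s ('D_v f).
Proof. by elim: s => //= w s ->. Qed.

Lemma smooth_uptoS k f : smooth_upto k.+1 f <->
  (forall x, differentiable f x) /\ forall v, smooth_upto k ('D_v f).
Proof.
split=> [fk|[f0 fk] s x].
  split=> [x|v s x sk]; first exact: (fk [::]).
  by rewrite -iter_derive_rcons; apply: fk; rewrite size_rcons.
case/lastP: s => [|s v]; first by move=> _; exact: f0.
by rewrite size_rcons iter_derive_rcons; exact: fk.
Qed.

Lemma smooth_uptoW k f : smooth_upto k.+1 f -> smooth_upto k f.
Proof. by move=> fk s x sk; apply: fk; exact: leqW. Qed.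

Lemma smoothP f : smooth f <-> forall k, smooth_upto k f.
Proof. by split=> [fs k s x _|fs s x]; [exact: fs|exact: (fs (size s))]. Qed.

Lemma smooth_differentiable f x : smooth f -> differentiable f x.
Proof. by move=> /(_ [::] x). Qed.

Lemma smooth_continuous f : smooth f -> continuous f.
Proof. by move=> fs x; apply: differentiable_continuous; exact: smooth_differentiable. Qed.

Lemma smooth_derive f v : smooth f -> smooth ('D_v f).
Proof. by move=> fs s x; rewrite -iter_derive_rcons; exact: fs. Qed.

Lemma smooth_upto_cst k (a : R) : smooth_upto k (cst a : V -> R^o).
Proof.
elim: k a => [|k IH] a; first by move=> [|//] x _; exact: differentiable_cst.
apply/smooth_uptoS; split=> [x|v]; first exact: differentiable_cst.
by rewrite (_ : 'D_v _ = cst 0) //; apply/funext => x; rewrite derive_cst.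
Qed.

Lemma smooth_cst (a : R) : smooth (cst a : V -> R^o).
Proof. by apply/smoothP => k; exact: smooth_upto_cst. Qed.

Lemma smooth_uptoD k f g :
  smooth_upto k f -> smooth_upto k g -> smooth_upto k (f \+ g).
Proof.
elim: k => [|k IH] in f g *.
  by move=> f0 g0 [|//] x _; apply: differentiableD; [exact: (f0 [::])|exact: (g0 [::])].
move=> /smooth_uptoS[f0 fk] /smooth_uptoS[g0 gk]; apply/smooth_uptoS; split=> [x|v].
  by apply: differentiableD.
rewrite (_ : 'D_v _ = 'D_v f \+ 'D_v g); first by apply: IH.
by apply/funext => x; rewrite deriveD//; exact: diff_derivable.
Qed.

Lemma smooth_uptoM k f g :
  smooth_upto k f -> smooth_upto k g -> smooth_upto k (fun x => f x * g x).
Proof.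
elim: k => [|k IH] in f g *.
  move=> f0 g0 [|//] x _; apply: (@differentiableM _ _ f g);
    [exact: (f0 [::])|exact: (g0 [::])].
move=> fS gS; move: (fS) (gS) => /smooth_uptoS[f0 fk] /smooth_uptoS[g0 gk].
apply/smooth_uptoS; split=> [x|v]; first exact: (@differentiableM _ _ f g).
rewrite (_ : 'D_v _ =
    (fun x => f x * 'D_v g x) \+ (fun x => g x * 'D_v f x)).
  by apply: smooth_uptoD; apply: IH => //; exact: smooth_uptoW.
by apply/funext => x; rewrite (@deriveM _ _ f g)//; exact: diff_derivable.
Qed.

Lemma smoothD f g : smooth f -> smooth g -> smooth (f \+ g).
Proof. by move=> /smoothP fs /smoothP gs; apply/smoothP => k; exact: smooth_uptoD. Qed.

Lemma smoothM f g : smooth f -> smooth g -> smooth (fun x => f x * g x).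
Proof. by move=> /smoothP fs /smoothP gs; apply/smoothP => k; exact: smooth_uptoM. Qed.

Lemma smooth_sum (I : Type) (r : seq I) (F : I -> V -> R^o) :
  (forall i, smooth (F i)) -> smooth (fun x => \sum_(i <- r) F i x).
Proof.
move=> Fs; elim: r => [|i r IH].
  rewrite (_ : (fun _ => _) = cst 0); first exact: smooth_cst.
  by apply/funext => x; rewrite big_nil.
rewrite (_ : (fun _ => _) = F i \+ (fun x => \sum_(i <- r) F i x)).
  exact: smoothD.
by apply/funext => x; rewrite big_cons.
Qed.

Lemma smooth_prod (I : Type) (r : seq I) (F : I -> V -> R^o) :
  (forall i, smooth (F i)) -> smooth (fun x => \prod_(i <- r) F i x).
Proof.
move=> Fs; elim: r => [|i r IH].
  rewrite (_ : (fun _ => _) = cst 1); first exact: smooth_cst.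
  by apply/funext => x; rewrite big_nil.
rewrite (_ : (fun _ => _) = (fun x => F i x * (\prod_(i <- r) F i x))).
  exact: smoothM.
by apply/funext => x; rewrite big_cons.
Qed.

Lemma differentiable_linear f x : linear f -> continuous f -> differentiable f x.
Proof.
move=> lf cf; pose lfM := GRing.isLinear.Build _ _ _ _ f lf.
pose F : {linear V -> R^o} := HB.pack f lfM.
exact: (@linear_differentiable _ _ _ F).
Qed.

Lemma derive_linear f v x : linear f -> continuous f -> 'D_v f x = f v.
Proof.
move=> lf cf; rewrite deriveE; last exact: differentiable_linear.
pose lfM := GRing.isLinear.Build _ _ _ _ f lf.
pose F : {linear V -> R^o} := HB.pack f lfM.
by rewrite (@diff_lin _ _ _ F).
Qed.

Lemma smooth_linear f : linear f -> continuous f -> smooth f.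
Proof.
move=> lf cf; have df x : differentiable f x by exact: differentiable_linear.
apply/smoothP => -[|k]; first by move=> [|//] x _; exact: df.
apply/smooth_uptoS; split=> // v.
rewrite (_ : 'D_v f = cst (f v)); first exact: smooth_upto_cst.
by apply/funext => x; exact: derive_linear.
Qed.

Lemma derive_shiftr f v a x : 'D_v (fun z => f (z + a)) x = 'D_v f (x + a).
Proof.
by rewrite /derive /=; under eq_fun do rewrite -addrA.
Qed.

Lemma iter_derive_shift s f a :
  iter_derive s (fun z => f (z + a)) = (fun z => iter_derive s f (z + a)).
Proof.
by elim: s => //= v s ->; apply/funext => x; exact: derive_shiftr.
Qed.

Lemma smooth_shift f a : smooth f -> smooth (fun z => f (z + a)).
Proof.
move=> fs s x; rewrite iter_derive_shift.
apply: (@differentiable_comp _ _ _ _ (fun z => z + a)); last exact: fs.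
apply: differentiableD; last exact: differentiable_cst.
exact: ex_diff.
Qed.

End smooth_theory.

(** * Uniform approximation by smooth functions *)

Section polynomial_closure.
Variables (R : realType) (T : Type) (N : nat) (coords : T -> 'rV[R]_N).
Variable Q : (T -> R) -> Prop.
Hypothesis Qcst : forall a, Q (cst a).
Hypothesis QD : forall f g, Q f -> Q g -> Q (f \+ g).
Hypothesis QM : forall f g, Q f -> Q g -> Q (f \* g).
Hypothesis Qcoord : forall i, Q (fun w => coords w 0 i).

(** One induction over monomials and exponents serves both uses: [Q] is measurability for
    polynomials in x or in jets, and smoothness for polynomials in (x, y). *)
Lemma polynomial_in_closed f : polynomial_in coords f -> Q f.
Proof.
move=> [P /funext ->].
under eq_fun do rewrite mpoly.mevalE.
elim: (mpoly.msupp P) => [|m s IH].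
  by under eq_fun do rewrite big_nil; exact: Qcst.
under eq_fun do rewrite big_cons; apply: QD => //.
apply: (QM (Qcst _)).
elim: (index_enum _) => [|i t IHt].
  by under eq_fun do rewrite big_nil; exact: Qcst.
under eq_fun do rewrite big_cons; apply: QM => //.
elim: (mpoly.fun_of_multinom m i) => [|k IHk]; first exact: Qcst.
by under eq_fun do rewrite exprS; exact: QM.
Qed.

End polynomial_closure.

(** * Moments of independent coin flips, for Bernstein approximation *)

Section coin_flips.
Variables (R : realType) (T : finType) (p : T -> R).

Let w t (b : bool) : R := if b then p t else 1 - p t.

(** The probability of the outcome [k] when flip [t] succeeds with probability [p t], independently
    of the others. *)
Definition flip_weight (k : {ffun T -> bool}) : R := \prod_t w t (k t).

(** Independence: the expectation of a product is the product of the expectations, by distributivity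
    of the product over the sums. *)
Lemma sum_flip_weightM (h : T -> bool -> R) :
  \sum_k flip_weight k * \prod_t h t (k t) =
  \prod_t (p t * h t true + (1 - p t) * h t false).
Proof.
rewrite [RHS](eq_bigr (fun t => \sum_b w t b * h t b)); last first.
  by move=> t _; rewrite big_bool.
rewrite bigA_distr_bigA; apply: eq_bigr => k _.
by rewrite big_split.
Qed.

Lemma sum_flip_weight : \sum_k flip_weight k = 1.
Proof.
have := sum_flip_weightM (fun _ _ => 1).
rewrite (eq_bigr flip_weight) => [->|k _]; last by rewrite big1 ?mulr1.
by rewrite big1// => t _; rewrite !mulr1 addrC subrK.
Qed.

Lemma flip_weight_ge0 k : (forall t, 0 <= p t <= 1) -> 0 <= flip_weight k.
Proof.
move=> p01; apply: prodr_ge0 => t _; rewrite /w.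
by case: (k t); have /andP[] := p01 t; rewrite ?subr_ge0.
Qed.

Lemma flip_covariance t u :
  \sum_k flip_weight k * (((k t)%:R - p t) * ((k u)%:R - p u)) =
  if t == u then p t * (1 - p t) else 0.
Proof.
(* The two centred factors are written as a product over all flips, with factor 1 away from [t] and
   [u]; when [t = u] both sit in the same factor, which gives the variance. *)
pose h v (b : bool) : R := (if v == t then b%:R - p t else 1) *
  (if v == u then b%:R - p u else 1).
rewrite (eq_bigr (fun k => flip_weight k * \prod_v h v (k v))); last first.
  move=> k _; congr (_ * _); rewrite big_split/=.
  by rewrite -!big_mkcond/= !big_pred1_eq.
rewrite sum_flip_weightM (bigD1 t)//= /h eqxx.
have [<-|tu] := eqVneq t u.
  rewrite big1 => [|v /negPf ->]; last by ring.
  by rewrite /= mulr1; ring.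
by rewrite /= !mulr1 (_ : p t * _ + _ = 0) ?mul0r//; ring.
Qed.

(** After expanding the square only the diagonal survives, and each [p t * (1 - p t)] is at most
    1. *)
Lemma flip_variance (A : pred T) : (forall t, 0 <= p t <= 1) ->
  \sum_k flip_weight k * (\sum_(t | A t) ((k t)%:R - p t)) ^+ 2 <= #|A|%:R.
Proof.
move=> p01.
rewrite (eq_bigr (fun k => \sum_(t | A t) \sum_(u | A u)
    flip_weight k * (((k t)%:R - p t) * ((k u)%:R - p u)))); last first.
  move=> k _; rewrite expr2 big_distrlr/= mulr_sumr; apply: eq_bigr => t _.
  by rewrite mulr_sumr.
rewrite exchange_big/= -sum1_card natr_sum; apply: ler_sum => t At.
rewrite exchange_big/= (bigD1 t)//= flip_covariance eqxx big1 ?addr0; last first.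
  by move=> u /andP[_ /negPf ut]; rewrite flip_covariance eq_sym ut.
by have /andP[p0 p1] := p01 t; rewrite mulr_ile1 ?subr_ge0// lerBlDr lerDl.
Qed.

End coin_flips.

Lemma le_coord_mx_norm (R : realType) m n (A : 'M[R]_(m, n)) i j :
  `|A i j| <= `|A|.
Proof.
by rewrite [leRHS]/Num.Def.normr/= mx_normrE (le_bigmax _ _ (i, j)).
Qed.

Lemma mx_norm_le (R : realType) m n (A : 'M[R]_(m, n)) (e : R) : 0 <= e ->
  (forall i j, `|A i j| <= e) -> `|A| <= e.
Proof.
move=> e0 Ae.
by rewrite [leLHS]/Num.Def.normr/= mx_normrE bigmax_le// => -[i j] _; exact: Ae.
Qed.

Lemma compact_cube (R : realType) n (r : R) : compact [set x : 'rV[R]_n | `|x| <= r].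
Proof.
apply: bounded_closed_compact.
  by exists r; split=> //= M rM x /= /le_trans; apply; exact: ltW.
apply: (@preimage_closed _ _ (fun x : 'rV[R]_n => `|x|) [set y | y <= r]).
  by move=> x _; exact: norm_continuous.
exact: closed_le.
Qed.

(** Continuity is assumed at the points of [K] only, yet [z] ranges over the whole space: a covering
    of [K] by half-size balls provides the common radius. *)
Lemma compact_uniform_continuity (R : realType) (V W : normedModType R)
    (K : set V) (f : V -> W) (e : R) : 0 < e -> compact K ->
  (forall x, K x -> {for x, continuous f}) ->
  exists2 d : R, 0 < d & forall x z, K x -> `|x - z| < d -> `|f x - f z| <= e.
Proof.
move=> e0 /compact_near_coveringP cK cf.
have : \forall d \near (0 : R)^'+, K `<=` [set x | forall z, `|x - z| < d -> `|f x - f z| <= e].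
  apply: cK => x Kx.
  have e20 : 0 < e / 2 by rewrite divr_gt0.
  have /cvgrPdist_lt/(_ _ e20)/nbhs_ballP[r /= r0 fr] := cf x Kx.
  have r20 : 0 < r / 2 by rewrite divr_gt0.
  near=> x' d => z x'z.
  have xx' : `|x - x'| < r / 2.
    by near: x'; apply/nbhs_ballP; exists (r / 2) => //= t; rewrite -ball_normE.
  have dr : d < r / 2 by near: d; exact: nbhs_right_lt.
  rewrite (splitr e) (le_trans (ler_distD (f x) _ _))// lerD// ltW//.
    rewrite distrC; apply: fr; rewrite -ball_normE/=.
    by rewrite (lt_le_trans xx')// ler_pdivrMr// ler_peMr// ?ltW// ltrDl.
  apply: fr; rewrite -ball_normE/= (le_lt_trans (ler_distD x' _ _))//.
  by rewrite (splitr r) ltrD// (lt_trans x'z).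
rewrite /at_right => -[r /= r0 Kr].
exists (r / 2); first by rewrite divr_gt0.
move=> x z Kx; apply: Kr => //=; last by rewrite divr_gt0.
by rewrite sub0r normrN gtr0_norm ?divr_gt0// ltr_pdivrMr// ltr_pMr// ltrDl.
Unshelve. all: end_near. Qed.

Section smooth_density.
Variables (R : realType) (n : nat).

(* Bernstein's operator in n variables: each coordinate of x is replaced by the
   mean of N independent coin flips. *)
Lemma smooth_dense (K : set 'rV[R]_n) (c : 'rV[R]_n -> R) (e : R) :
  compact K -> continuous c -> 0 < e ->
  exists2 P : 'rV[R]_n -> R^o, smooth P & forall x, K x -> `|c x - P x| <= e.
Proof.
move=> cK cc e0.
have [r r0 Kr] : exists2 r : R, 0 < r & K `<=` [set x | `|x| <= r].
  have [M [_ MK]] := compact_bounded cK.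
  exists (`|M| + 1); first by rewrite ltr_wpDl.
  by apply: MK; rewrite (le_lt_trans (ler_norm _))// ltrDl.
have cube := @compact_cube R n r.
have [M M0 cM] : exists2 M : R, 0 < M & forall x : 'rV[R]_n, `|x| <= r -> `|c x| <= M.
  have /compact_bounded[M [_ MK]] := continuous_compact (continuous_subspaceT cc) cube.
  exists (`|M| + 1); first by rewrite ltr_wpDl.
  move=> x xr; apply: (MK (`|M| + 1)); last by exists x.
  by rewrite (le_lt_trans (ler_norm _))// ltrDl.
have e20 : 0 < e / 2 by rewrite divr_gt0.
have [d d0 cd] := @compact_uniform_continuity _ _ _ _ _ _ e20 cube (fun x _ => cc x).
(* Chebyshev's inequality costs [2 * M / d ^+ 2] per unit of squared distance, and [2 * r] rescales
   [[0, 1]] to [[-r, r]]. With n coordinates of variance at most N before division by [N ^+ 2], the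
   total is [C * n / N], and N makes it at most [e / 2]. *)
pose C := 2 * M / d ^+ 2 * (2 * r) ^+ 2.
have C0 : 0 < C by rewrite !(mulr_gt0, invr_gt0, exprn_gt0).
pose N := (Num.truncn (C * n%:R / (e / 2))).+1.
pose p (x : 'rV[R]_n) (t : 'I_n * 'I_N) : R := (x 0 t.1 + r) / (2 * r).
(* The success frequency of the N flips attached to coordinate i, mapped back to [[-r, r]]; its
   expectation under [p x] is [x 0 i]. *)
pose node (k : {ffun 'I_n * 'I_N -> bool}) : 'rV[R]_n :=
  \row_i (- r + 2 * r * ((\sum_(t | t.1 == i) (k t)%:R) / N%:R)).
exists (fun x => \sum_k c (node k) * flip_weight (p x) k).
  apply: smooth_sum => k; apply: smoothM; first exact: smooth_cst.
  apply: smooth_prod => t.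
  have sp : smooth (fun x => p x t : R^o).
    apply: (@smoothM _ _ (fun x : 'rV[R]_n => x 0 t.1 + r) (cst (2 * r)^-1));
      last exact: smooth_cst.
    apply: (@smoothD _ _ (fun x : 'rV[R]_n => x 0 t.1) (cst r)); last exact: smooth_cst.
    apply: smooth_linear; last exact: coord_continuous.
    by move=> a u v; rewrite !mxE.
  case: (k t) => //.
  apply: (@smoothD _ _ (cst 1) (fun x => - p x t)); first exact: smooth_cst.
  rewrite (_ : (fun _ => _) = fun x => (cst (-1) x * p x t)); last first.
    by apply/funext => x; rewrite mulN1r.
  by apply: smoothM => //; exact: smooth_cst.
move=> x /Kr/= xr.
have xir i : - r <= x 0 i <= r by rewrite -ler_norml (le_trans (le_coord_mx_norm _ _ _)).
have p01 t : 0 <= p x t <= 1.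
  have /andP[rx xr'] := xir t.1.
  have r20 : 0 < 2 * r by rewrite mulr_gt0.
  by rewrite /p ler_pdivlMr// mul0r ler_pdivrMr// mul1r; apply/andP; split; lra.
have cardN i : #|[pred t : 'I_n * 'I_N | t.1 == i]| = N.
  rewrite -sum1_card (eq_bigl (fun t : 'I_n * 'I_N => (t.1 == i) && true)).
    by rewrite -(pair_big (pred1 i) xpredT (fun _ _ => 1%N)) big_pred1_eq sum1_card card_ord.
  by move=> t; rewrite inE andbT.
have N0 : 0 < N%:R :> R by rewrite ltr0n.
have xnode k i : (x - node k) 0 i =
    - (2 * r) / N%:R * \sum_(t | t.1 == i) ((k t)%:R - p x t).
  rewrite !mxE sumrB [\sum_(t | _) p x t](eq_bigr (fun=> (x 0 i + r) / (2 * r))); last first.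
    by move=> t /eqP ti; rewrite /p ti.
  rewrite sumr_const cardN -[_ *+ N]mulr_natr; field.
  by rewrite !gt_eqF.
have nr k : `|node k| <= r.
  apply: mx_norm_le; first exact: ltW.
  move=> i j; rewrite ord1 mxE ler_norml; set q := _ / _.
  have q0 : 0 <= q by rewrite divr_ge0// sumr_ge0.
  have q1 : q <= 1.
    rewrite ler_pdivrMr ?mul1r ?ltr0n//.
    rewrite (@le_trans _ _ (\sum_(t : 'I_n * 'I_N | t.1 == j) 1))//.
      by apply: ler_sum => t _; case: (k t).
    by rewrite sumr_const cardN.
  by apply/andP; split; nra.
(* Near nodes are covered by the modulus of continuity. At a far node some coordinate differs by at
   least [d], so the crude bound [2 * M] is absorbed by the quadratic term. *)
have ck k : `|c x - c (node k)| <= e / 2 +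
    2 * M / d ^+ 2 * \sum_i ((x - node k) 0 i) ^+ 2.
  have S0 : 0 <= \sum_i ((x - node k) 0 i) ^+ 2 by apply: sumr_ge0 => i _; exact: sqr_ge0.
  have Md0 : 0 < 2 * M / d ^+ 2 by rewrite !(mulr_gt0, invr_gt0, exprn_gt0).
  have [xd|dx] := ltP `|x - node k| d.
    by rewrite (le_trans (cd _ _ xr xd))// lerDl mulr_ge0// ltW.
  rewrite (@le_trans _ _ (2 * M))//.
    by rewrite (le_trans (ler_normB _ _))// mulr_natl mulr2n lerD// cM.
  rewrite -[leLHS]add0r lerD ?(ltW e20)// -mulrA ler_peMr ?mulr_ge0 ?(ltW M0)//.
  rewrite mulrC ler_pdivlMr ?exprn_gt0// mul1r.
  have [i di] : exists i, d <= `|(x - node k) 0 i|.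
    apply: contrapT => /forallNP h; move: dx; apply/negP; rewrite -ltNge.
    rewrite [ltLHS]/Num.Def.normr/= mx_normrE bigmax_lt// => -[a b] _ /=.
    by rewrite ord1 ltNge; exact/negP/h.
  rewrite (bigD1 i)//= (@le_trans _ _ ((x - node k) 0 i ^+ 2))//.
    by rewrite -[leRHS]real_normK ?num_real// lerXn2r// nnegrE ltW.
  by rewrite lerDl sumr_ge0// => j _; exact: sqr_ge0.
rewrite -[c x]mulr1 -(sum_flip_weight (p x)) mulr_sumr -sumrB.
rewrite (le_trans (ler_norm_sum _ _ _))//.
pose W k := flip_weight (p x) k.
have W0 k : 0 <= W k by exact: flip_weight_ge0.
apply: (@le_trans _ _ (\sum_k (W k * (e / 2) + C / N%:R ^+ 2 *
    \sum_i W k * (\sum_(t | t.1 == i) ((k t)%:R - p x t)) ^+ 2))).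
  apply: ler_sum => k _; rewrite -mulrBl normrM (ger0_norm (W0 k)) mulrC.
  apply: (le_trans (ler_wpM2l (W0 k) (ck k))).
  rewrite mulrDr lerD2l mulrA [leLHS]mulr_sumr [leRHS]mulr_sumr; apply: ler_sum => i _.
  rewrite xnode exprMn le_eqVlt; apply/orP; left; apply/eqP.
  by rewrite /C; field; rewrite !gt_eqF.
rewrite big_split/= -mulr_suml sum_flip_weight mul1r -mulr_sumr exchange_big/=.
rewrite {2}(splitr e) lerD2l.
apply: (@le_trans _ _ (C / N%:R ^+ 2 * \sum_(i < n) N%:R)).
  rewrite ler_wpM2l//; first by rewrite divr_ge0 ?(ltW C0)// exprn_ge0 ?(ltW N0).
  apply: ler_sum => i _; rewrite -[in leRHS](cardN i).
  exact: (flip_variance [pred t : 'I_n * 'I_N | t.1 == i]).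
rewrite sumr_const card_ord -[_ *+ n]mulr_natr.
rewrite (_ : _ * _ = C * n%:R / N%:R); last by field; rewrite gt_eqF.
rewrite ler_pdivrMr// [leRHS]mulrC -ler_pdivrMr// ltW//.
exact: truncnS_gt.
Qed.

End smooth_density.

(** * Lebesgue measure on R^n *)

Section ae_integral.
Context d (T : measurableType d) (R : realType).
Variable mu : {measure set T -> \bar R}.
Local Open Scope ereal_scope.

Import HBNNSimple.

Let ae_ge0_le_integral_nomeas (f g : T -> \bar R) :
  (forall x, 0 <= f x) -> (forall x, 0 <= g x) ->
  {ae mu, forall x, f x = g x} -> \int[mu]_x f x <= \int[mu]_x g x.
Proof.
move=> f0 g0 [N [mN N0 fgN]]; rewrite !ge0_integralTE//.
apply: ge_ereal_sup => _ [h hf <-].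
(* A simple function below [f] is set to 0 on the null set: it is then below [g] everywhere and has
   the same integral. *)
apply: ereal_sup_ubound; exists (proj_nnsfun h (measurableC mN)).
  move=> x; rewrite -mrestrict/= patchE.
  case: ifPn => xN; last exact: g0.
  have -> : g x = f x.
    by apply: esym; apply: contrapT => fgx; move/set_mem: xN; apply; exact: fgN.
  exact: hf.
rewrite -2!(integralT_nnsfun mu); apply: ge0_ae_eq_integral => //.
- exact/measurable_EFinP.
- exact/measurable_EFinP.
- by move=> x _; rewrite lee_fin.
- by move=> x _; rewrite lee_fin.
exists N; split => // x /= hN; apply: contrapT => xN; apply: hN => _.
by rewrite mindicE mem_set ?mulr1.
Qed.

(* The integral is a supremum over simple functions below the integrand, so
   that no measurability is needed. *)
Lemma ae_eq_integral_nomeas (D : set T) (f g : T -> \bar R) :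
  {ae mu, forall x, D x -> f x = g x} ->
  \int[mu]_(x in D) f x = \int[mu]_(x in D) g x.
Proof.
move=> fg; rewrite integral_mkcond [RHS]integral_mkcond.
have {}fg : {ae mu, forall x, (f \_ D) x = (g \_ D) x}.
  apply: filterS fg => x fg; rewrite !patchE; case: ifPn => // /set_mem.
  exact: fg.
rewrite integralE [RHS]integralE.
suff H (p q : T -> \bar R) : (forall x, 0 <= p x) -> (forall x, 0 <= q x) ->
    {ae mu, forall x, p x = q x} -> \int[mu]_x p x = \int[mu]_x q x.
  by congr (_ - _); apply: H => //; apply: filterS fg => x fgx;
    rewrite ?funeposE ?funenegE fgx.
move=> p0 q0 pq; apply/eqP; rewrite eq_le; apply/andP.
by split; apply: ae_ge0_le_integral_nomeas => //; apply: filterS pq => x ->.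
Qed.

Lemma ae_eq_Rintegral_nomeas (D : set T) (f g : T -> R) :
  {ae mu, forall x, D x -> f x = g x} ->
  (\int[mu]_(x in D) f x = \int[mu]_(x in D) g x)%R.
Proof.
move=> fg; congr fine; apply: ae_eq_integral_nomeas.
by apply: filterS fg => x fg /fg ->.
Qed.

End ae_integral.

Section lebesgue_rV_theory.
Variables (R : realType) (n : nat).
Local Notation X := 'rV[R]_n.
Local Notation lam := (@lebesgue_rV R n).
Implicit Types a b x z : X.

Definition box a b : set X := [set x | forall i, a 0 i <= x 0 i <= b 0 i].

Definition boxes : set (set X) := [set A | exists a b, A = box a b].

Lemma boxes_setI : setI_closed boxes.
Proof.
move=> _ _ [a [b ->]] [c [d ->]].
exists (\row_i Num.max (a 0 i) (c 0 i)), (\row_i Num.min (b 0 i) (d 0 i)).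
apply/seteqP; split=> [x [ab cd] i|x abcd].
  by rewrite !mxE ge_max le_min; have /andP[-> ->] := ab i; exact: cd.
by split=> i; have := abcd i; rewrite !mxE ge_max le_min;
  move=> /andP[/andP[ax cx] /andP[xb xd]]; apply/andP.
Qed.

Lemma measurable_boxes : @measurable _ X = <<s boxes >>.
Proof.
apply/seteqP; split; last first.
  apply: smallest_sub; first exact: sigma_algebra_measurable.
  by move=> _ [a [b ->]]; exact: measurable_box.
have mid : measurable_fun setT (id : g_sigma_algebraType boxes -> X).
  apply: measurable_fun_mx => i j; rewrite ord1.
  move=> mT; move: (mT); apply: (measurability _ (RGenCInfty.measurableE R)).
  move=> _ [_ [r ->] <-]; rewrite setTI.
  (* A half-line in coordinate [j] is exhausted by boxes whose remaining sides grow with [k]. *)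
  rewrite (_ : _ @^-1` _ = \bigcup_(k : nat)
      box (\row_h if h == j then r else - k%:R) (const_mx k%:R)).
    by apply: bigcupT_measurable => k; apply: sub_sigma_algebra; do 2 eexists.
  apply/seteqP; split=> [x|x [k _]]/=.
    rewrite in_itv/= andbT => rx.
    exists (Num.truncn `|x : X|).+1 => // h; rewrite !mxE.
    have : `|x 0 h| <= (Num.truncn `|x : X|).+1%:R.
      by rewrite (le_trans (le_coord_mx_norm _ _ _))// ltW// truncnS_gt.
    by rewrite ler_norml => /andP[? ->]; case: eqP => [->|_]; rewrite andbT.
  by move=> /(_ j); rewrite !mxE eqxx in_itv/= andbT => /andP[].
by move=> A mA; have := mid measurableT A mA; rewrite setTI.
Qed.

Lemma lebesgue_rV_box_shift a b z :
  lam ((fun x => x + z) @^-1` box a b) = lam (box a b).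
Proof.
have -> : (fun x => x + z) @^-1` box a b = box (a - z) (b - z).
  apply/seteqP; split=> x abx i; have := abx i; rewrite !mxE => /andP[];
  by rewrite lerBlDr lerBrDr => -> ->.
have [ab|] := pselect (forall i, a 0 i <= b 0 i).
  rewrite !lebesgue_rV_box//; last by move=> i; rewrite !mxE lerD2r.
  by congr (_%:E); apply: eq_bigr => i _; rewrite !mxE; ring.
move=> /existsNP[i /negP]; rewrite -ltNge => ba.
have box0 (c d : X) : d 0 i < c 0 i -> box c d = set0.
  move=> dc; apply/seteqP; split=> // x /(_ i)/andP[cx xd]/=.
  by have := le_lt_trans (le_trans cx xd) dc; rewrite ltxx.
by rewrite !box0// !mxE ltrD2r.
Qed.

Lemma measurable_shift_rV z : measurable_fun setT (fun x => x + z).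
Proof.
apply: measurable_fun_mx => i j; under eq_fun do rewrite mxE.
by apply: measurable_funD => //; exact: measurable_coord.
Qed.

Lemma lebesgue_rV_cube_lty (r : R) : (lam [set x | (`|x| <= r)%R] < +oo)%E.
Proof.
have [r0|r0] := leP 0 r; last first.
  rewrite (_ : mkset _ = set0) ?measure0//; apply/seteqP; split=> // x /= xr.
  by have := le_lt_trans (le_trans (normr_ge0 x) xr) r0; rewrite ltxx.
rewrite (_ : mkset _ = box (const_mx (- r)) (const_mx r)).
  by rewrite lebesgue_rV_box ?ltry// => i; rewrite !mxE ge0_cp.
apply/seteqP; split=> x /= xr.
  by move=> i; rewrite !mxE -ler_norml (le_trans (le_coord_mx_norm _ _ _)).
apply: mx_norm_le => // i j; rewrite ord1 ler_norml.
by have := xr j; rewrite !mxE.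
Qed.

(** A shifted box is a box with the same side lengths; boxes form a pi-system generating the Borel
    sets, and the cubes of half-side [k] exhaust the space with finite measure. *)
Lemma lebesgue_rV_shift z A : measurable A ->
  lam ((fun x => x + z) @^-1` A) = lam A.
Proof.
pose nu : {measure set X -> \bar R} :=
  measure_function_pushforward__canonical__measure_function_Measure
    lam (measurable_shift_rV z).
move=> mA; apply/esym.
have := @measure_unique _ R X boxes
  (fun k => box (const_mx (- k%:R)) (const_mx k%:R)) measurable_boxes
  boxes_setI _ _ lam nu _ _ A mA.
apply.
- by move=> k; do 2 eexists.
- apply/seteqP; split=> // x _; exists (Num.truncn `|x|).+1 => // h; rewrite !mxE.
  by rewrite -ler_norml (le_trans (le_coord_mx_norm _ _ _))// ltW// truncnS_gt.
- by move=> _ [a [b ->]]; rewrite /= /pushforward lebesgue_rV_box_shift.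
- by move=> k /=; rewrite lebesgue_rV_box ?ltry// => i; rewrite !mxE ge0_cp.
Qed.

End lebesgue_rV_theory.

Section locally_bounded.
Variables (R : realType) (n : nat).
Local Notation X := 'rV[R]_n.
Local Notation lam := (@lebesgue_rV R n).
Implicit Types f g : X -> R.

(** This class holds both the continuous functions and the bounded Borel derivatives, and is stable
    under sums, products and translations. One factor of bounded support makes a member integrable,
    which settles the integrability conditions below mechanically. *)
Definition locally_bounded_measurable f := measurable_fun setT f /\
  forall r, exists M, forall x, `|x| <= r -> `|f x| <= M.

Definition bounded_support f := exists r : R, forall x, r < `|x| -> f x = 0.

Lemma continuous_measurable_rV f : continuous f -> measurable_fun setT f.
Proof.
move=> cf mT; move: (mT); apply: (measurability _ (RGenOpens.measurableE R)).
move=> _ [_ [a [b ->]] <-]; rewrite setTI; apply: sub_sigma_algebra.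
by apply: open_comp; [move=> x _; exact: cf|exact: interval_open].
Qed.

Lemma lbm_continuous f : continuous f -> locally_bounded_measurable f.
Proof.
move=> cf; split=> [|r]; first exact: continuous_measurable_rV.
have /compact_bounded[M [_ MK]] :=
  continuous_compact (continuous_subspaceT cf) (@compact_cube R n r).
exists (`|M| + 1) => x xr; apply: (MK (`|M| + 1)); last by exists x.
by rewrite (le_lt_trans (ler_norm _))// ltrDl.
Qed.

Lemma lbm_bounded f M : measurable_fun setT f -> (forall x, `|f x| <= M) ->
  locally_bounded_measurable f.
Proof. by move=> mf fM; split=> // r; exists M. Qed.

Lemma lbmD f g : locally_bounded_measurable f -> locally_bounded_measurable g ->
  locally_bounded_measurable (fun x => f x + g x).
Proof.
move=> [mf bf] [mg bg]; split=> [|r]; first exact: measurable_funD.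
have [M fM] := bf r; have [N gN] := bg r; exists (M + N) => x xr.
by rewrite (le_trans (ler_normD _ _))// lerD ?fM ?gN.
Qed.

Lemma lbmM f g : locally_bounded_measurable f -> locally_bounded_measurable g ->
  locally_bounded_measurable (fun x => f x * g x).
Proof.
move=> [mf bf] [mg bg]; split=> [|r]; first exact: measurable_funM.
have [M fM] := bf r; have [N gN] := bg r; exists (M * N) => x xr.
by rewrite normrM ler_pM ?fM ?gN.
Qed.

Lemma lbm_cst (a : R) : locally_bounded_measurable (cst a).
Proof. by apply: lbm_continuous; exact: cst_continuous. Qed.

Lemma lbmB f g : locally_bounded_measurable f -> locally_bounded_measurable g ->
  locally_bounded_measurable (fun x => f x - g x).
Proof.
move=> lf lg; rewrite (_ : (fun _ => _) = (fun x => f x + -1 * g x)).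
  by apply: lbmD => //; apply: lbmM => //; exact: lbm_cst.
by apply/funext => x; rewrite mulN1r.
Qed.

Lemma lbm_norm f : locally_bounded_measurable f ->
  locally_bounded_measurable (fun x => `|f x|).
Proof.
move=> [mf bf]; split=> [|r]; first exact: measurableT_comp.
by have [M fM] := bf r; exists M => x xr; rewrite normr_id fM.
Qed.

Lemma lbm_sum (I : Type) (s : seq I) (P : pred I) (F : I -> X -> R) :
  (forall i, P i -> locally_bounded_measurable (F i)) ->
  locally_bounded_measurable (fun x => \sum_(i <- s | P i) F i x).
Proof.
move=> lF; elim: s => [|i s IH].
  by under eq_fun do rewrite big_nil; exact: lbm_cst.
under eq_fun do rewrite big_cons.
by case: (boolP (P i)) => // Pi; apply: lbmD => //; exact: lF.
Qed.

Lemma bounded_supportMl f g : bounded_support f ->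
  bounded_support (fun x => f x * g x).
Proof. by move=> [r fr]; exists r => x /fr ->; rewrite mul0r. Qed.

Lemma bounded_supportMr f g : bounded_support f ->
  bounded_support (fun x => g x * f x).
Proof. by move=> [r fr]; exists r => x /fr ->; rewrite mulr0. Qed.

Lemma bounded_support_norm f : bounded_support f ->
  bounded_support (fun x => `|f x|).
Proof. by move=> [r fr]; exists r => x /fr ->; rewrite normr0. Qed.

Lemma bounded_supportD f g : bounded_support f -> bounded_support g ->
  bounded_support (fun x => f x + g x).
Proof.
move=> [r fr] [s gs]; exists (Num.max r s) => x.
by rewrite gt_max => /andP[rx sx]; rewrite fr// gs// addr0.
Qed.

Lemma bounded_support_sum (I : Type) (s : seq I) (F : I -> X -> R) :
  (forall i, bounded_support (F i)) ->
  bounded_support (fun x => \sum_(i <- s) F i x).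
Proof.
move=> bF; elim: s => [|i s IH].
  by exists 0 => x _; rewrite big_nil.
by under eq_fun do rewrite big_cons; exact: bounded_supportD.
Qed.

Lemma measurable_cube (r : R) : measurable [set x : X | `|x| <= r].
Proof.
have /(_ measurableT `]-oo, r]%classic) := continuous_measurable_rV (@norm_continuous _ X).
by rewrite setTI set_itvNyc; apply; rewrite -set_itvNyc; exact: measurable_itv.
Qed.

Lemma lbm_integrable f : locally_bounded_measurable f -> bounded_support f ->
  lam.-integrable setT (EFin \o f).
Proof.
move=> [mf bf] [r fr].
have -> : EFin \o f = (EFin \o f) \_ [set x | `|x| <= r].
  apply/funext => x; rewrite patchE; case: ifPn => //.
  by rewrite notin_setE /= => /negP; rewrite -ltNge => /fr ->.
apply/(integrable_mkcond _ (measurable_cube r)).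
apply: measurable_bounded_integrable; first exact: measurable_cube.
- exact: lebesgue_rV_cube_lty.
- exact: measurable_funTS.
have [M fM] := bf r; exists M; split; rewrite ?num_real// => N MN x /= xr.
by rewrite (le_trans (fM _ xr))// ltW.
Qed.

Lemma lbm_shift f z : locally_bounded_measurable f ->
  locally_bounded_measurable (fun x => f (x + z)).
Proof.
move=> [mf bf]; split=> [|r].
  by apply: measurableT_comp => //; exact: measurable_shift_rV.
have [M fM] := bf (r + `|z|); exists M => x xr; apply: fM.
by rewrite (le_trans (ler_normD _ _))// lerD2r.
Qed.

Lemma bounded_support_shift f z : bounded_support f ->
  bounded_support (fun x => f (x + z)).
Proof.
move=> [r fr]; exists (r + `|z|) => x rx; apply: fr.
by rewrite -(opprK z) (lt_le_trans _ (lerB_dist _ _))// normrN ltrBrDr.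
Qed.

Lemma Rintegral_shift f z : locally_bounded_measurable f -> bounded_support f ->
  \int[lam]_x f (x + z) = \int[lam]_x f x.
Proof.
move=> lf bf; congr fine.
have mf : measurable_fun setT (EFin \o f) by apply/measurable_EFinP; case: lf.
transitivity (\int[pushforward lam (fun x : X => (x + z)%R)]_x (f x)%:E)%E.
  rewrite (integral_pushforward (measurable_shift_rV z) mf)//.
  rewrite preimage_setT; apply: lbm_integrable.
    exact: lbm_shift.
  exact: bounded_support_shift.
apply: eq_measure_integral => [|mz A mA _]; first exact: measurable_shift_rV.
exact: lebesgue_rV_shift.
Qed.

End locally_bounded.

(** * Difference quotients and weak derivatives *)

Section line_derivative.
Variables (R : realType) (V : normedModType R).
Implicit Types f : V -> R^o.

Lemma is_derive_line f a v (s : R) : differentiable f (a + s *: v) ->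
  is_derive s 1 (fun t : R => f (a + t *: v)) ('D_v f (a + s *: v)).
Proof.
move=> /(diff_derivable (v := v)) df.
have E : (fun h : R => h^-1 *: ((fun t : R => f (a + t *: v)) (h *: 1 + s) -
      f (a + s *: v))) =
    (fun h => h^-1 *: ((f \o shift (a + s *: v)) (h *: v) - f (a + s *: v))).
  apply/funext => h /=; congr (_ *: (f _ - _)).
  by rewrite scalerDl -scalerA scale1r addrCA.
by apply: DeriveDef; [rewrite /derivable|rewrite /derive]; rewrite E.
Qed.

Lemma deriveNdir f v x : differentiable f x -> 'D_(- v) f x = - 'D_v f x.
Proof. by move=> df; rewrite !deriveE// linearN. Qed.

End line_derivative.

Section smooth_bounded_support.
Variables (R : realType) (n : nat).
Local Notation X := 'rV[R]_n.
Implicit Types f : X -> R^o.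

Lemma derive_locally0 f v (U : set X) x : open U -> U x ->
  (forall z, U z -> f z = 0) -> 'D_v f x = 0.
Proof.
move=> oU Ux f0.
rewrite -[RHS](derive_cst (0 : R^o) x v); apply: near_eq_derive.
by near=> z; apply: f0; near: z; exact: open_nbhs_nbhs.
Unshelve. all: end_near. Qed.

Lemma derive_out_compact f v (K : set X) x : compact K ->
  (forall z, ~ K z -> f z = 0) -> ~ K x -> 'D_v f x = 0.
Proof.
move=> cK fK Kx; apply: (@derive_locally0 _ _ (~` K)) => //.
by apply: closed_openC; apply: compact_closed => //; exact: norm_hausdorff.
Qed.

Lemma compact_support_bounded f (K : set X) : compact K ->
  (forall z, ~ K z -> f z = 0) -> bounded_support f.
Proof.
move=> /compact_bounded[M [_ MK]] fK; exists (`|M| + 1) => x Mx; apply: fK.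
move=> Kx; move: Mx; apply/negP; rewrite -leNgt; apply: (MK (`|M| + 1)) => //.
by rewrite (le_lt_trans (ler_norm _))// ltrDl.
Qed.

Lemma derive_bounded_support f v : bounded_support f -> bounded_support ('D_v f).
Proof.
move=> [r fr]; exists r => x rx.
apply: (@derive_locally0 _ _ [set z | r < `|z|]) => //.
apply: (@open_comp _ _ (fun z : X => `|z|) [set y | r < y]); last exact: open_gt.
by move=> z _; exact: norm_continuous.
Qed.

End smooth_bounded_support.

Section convolution.
Variables (R : realType) (n : nat).
Local Notation X := 'rV[R]_n.
Local Notation lam := (@lebesgue_rV R n).

(** All dependence on t sits in [psi], so [H] need only be continuous. Differentiation under the
    integral is dominated by a constant on a fixed cube. *)
Lemma is_derive_convolution (H : X -> R) (psi : X -> R^o) (w : X) (s : R) :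
  continuous H -> smooth psi -> bounded_support psi ->
  is_derive s 1 (fun t : R => \int[lam]_x (H x * psi (x + t *: w)))
    (\int[lam]_x (H x * 'D_w psi (x + s *: w))).
Proof.
move=> cH spsi bpsi.
have dbpsi := derive_bounded_support w bpsi.
pose f (t : R) x := H x * psi (x + t *: w).
have df (t : R) (x : X) : is_derive t 1 (f ^~ x) (H x * 'D_w psi (x + t *: w)).
  have dpsi := is_derive_line (smooth_differentiable (x + t *: w) spsi).
  exact: (@is_deriveZ _ _ _ (fun t : R => psi (x + t *: w)) (H x)).
have d1f (t : R) (x : X) : partial1of2 f t x = H x * 'D_w psi (x + t *: w).
  by rewrite partial1of2E derive_val.
have [r psir] := dbpsi.
(* For [|t - s| < 1] the function [x |-> 'D_w psi (x + t *: w)] vanishes outside the cube of radius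
   [r']. *)
pose r' := r + (`|s| + 1) * `|w|.
have [M HM] := (lbm_continuous cH).2 r'.
have lDpsi := lbm_continuous (smooth_continuous (smooth_derive w spsi)).
have [N psiN] := lDpsi.2 r.
pose G (x : X) : R := `|M| * `|N| * \1_[set x : X | `|x| <= r'] x.
have I0 : `]s - 1, s + 1[%classic s by rewrite /= in_itv/= ltrDl ltrBlDr ltrDl ltr01.
have intf (x : R) : `]s - 1, s + 1[%classic x -> lam.-integrable setT (EFin \o f x).
  move=> _; apply: lbm_integrable.
    apply: lbmM; first exact: lbm_continuous.
    apply: (lbm_shift (f := psi)).
    by apply: lbm_continuous; exact: smooth_continuous.
  apply: bounded_supportMr.
  exact: (bounded_support_shift (f := psi)).
have intG : lam.-integrable setT (EFin \o G).
  apply: lbm_integrable; last first.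
    exists r' => x; rewrite ltNge => /negP xr.
    by rewrite /G indicE memNset ?mulr0.
  apply: lbmM; first exact: lbm_cst.
  apply: (@lbm_bounded _ _ _ 1); last first.
    by move=> x; rewrite indicE; case: (_ \in _); rewrite ?normr1 ?normr0.
  by apply: measurable_indic; exact: measurable_cube.
have G0 x : 0 <= G x by rewrite !mulr_ge0.
have Gub (t : R) (x : X) : `]s - 1, s + 1[%classic t -> setT x ->
    `|partial1of2 f t x| <= G x.
  rewrite /= in_itv/= -ltr_distl distrC => ts _; rewrite d1f normrM.
  have tw : `|t *: w| <= (`|s| + 1) * `|w|.
    rewrite normrZ ler_wpM2r// -lerBlDl ltW// (le_lt_trans _ ts)//.
    by rewrite (le_trans (lerB_dist _ _))// distrC.
  have [xr|rx] := leP `|x| r'.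
    rewrite /G indicE mem_set// mulr1 ler_pM// ?(le_trans (HM _ xr)) ?ler_norm//.
    have [xtr|rxt] := leP `|x + t *: w| r.
      by rewrite (le_trans (psiN _ xtr)) ?ler_norm.
    by rewrite psir ?normr0.
  rewrite psir ?normr0 ?mulr0//.
  rewrite -(opprK (t *: w)) (lt_le_trans _ (lerB_dist _ _))// normrN ltrBrDr.
  by rewrite (le_lt_trans _ rx)// lerD2l.
have derf (t : R) (x : X) : `]s - 1, s + 1[%classic t -> setT x -> derivable (f ^~ x) t 1.
  by move=> _ _; have [] := df t x.
apply: DeriveDef.
  exact: (derivable_under_integral measurableT I0 intf derf G0 intG Gub).
rewrite -derive1E.
rewrite (differentiation_under_integral measurableT I0 intf derf G0 intG Gub).
by apply: eq_Rintegral => x _; rewrite d1f.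
Qed.

End convolution.

Lemma ler_of_eps (R : realType) (a b C : R) : 0 <= C ->
  (forall e, 0 < e -> a <= b + e * C) -> a <= b.
Proof.
move=> C0 h; apply/ler_addgt0Pr => e e0.
have C1 : 0 < C + 1 by rewrite ltr_wpDl.
apply: (le_trans (h (e / (C + 1)) _)); first by rewrite divr_gt0.
by rewrite lerD2l -mulrA ler_piMr ?(ltW e0)// mulrC ler_pdivrMr// mul1r lerDl.
Qed.

Ltac lbm := solve [repeat first [assumption |
  match goal with H : forall i, locally_bounded_measurable _ |- _ => exact: H end |
  exact: lbm_cst | apply: lbmM | apply: lbmB | apply: lbmD | apply: lbm_norm]].
Ltac bsup := solve [repeat first [assumption |
  solve [apply: bounded_supportMl; bsup] | solve [apply: bounded_supportMr; bsup] |
  apply: bounded_supportD | apply: bounded_support_norm]].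
Ltac lint := solve [apply: lbm_integrable; [lbm | bsup]].

Section lbm_integral.
Variables (R : realType) (n : nat).
Local Notation X := 'rV[R]_n.
Local Notation lam := (@lebesgue_rV R n).
Implicit Types f g : X -> R.

Lemma le_norm_Rintegral_lbm f g :
  locally_bounded_measurable f -> bounded_support f ->
  locally_bounded_measurable g -> bounded_support g ->
  (forall x, `|f x| <= g x) -> `|\int[lam]_x f x| <= \int[lam]_x g x.
Proof.
move=> lf bf lg bg fg.
apply: le_trans (le_normr_Rintegral measurableT (lbm_integrable lf bf)) _.
by apply: le_Rintegral => // [|]; lint.
Qed.

End lbm_integral.

Lemma shift_continuous (R : realType) (V : normedModType R) (z : V) :
  continuous (fun x => x + z).
Proof. by move=> x; exact: (cvgD cvg_id (cvg_cst _)). Qed.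

Section difference_quotient.
Variables (R : realType) (n : nat) (e : 'rV[R]_n).
Local Notation X := 'rV[R]_n.
Local Notation lam := (@lebesgue_rV R n).

Definition increment (H : X -> R) (t : R) (x : X) := H (x + t *: e) - H x.

Lemma continuous_increment H t : continuous H -> continuous (increment H t).
Proof.
move=> cH x.
have cs : {for x, continuous (H \o (fun z => z + t *: e))}.
  apply: continuous_comp; last exact: cH.
  exact: shift_continuous.
exact: cvgB cs (cH x).
Qed.

(** Translation invariance moves the shift from [H] to [psi], so that [J] is differentiable in t
    even when [H] is not. *)
Let J (H psi : X -> R) (t : R) := \int[lam]_x (H x * psi (x + t *: - e)).

Lemma Rintegral_increment H psi t : continuous H -> continuous psi ->
  bounded_support psi ->
  \int[lam]_x (increment H t x * psi x) = J H psi t - J H psi 0.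
Proof.
move=> cH cpsi bpsi.
have lH := lbm_continuous cH; have lpsi := lbm_continuous cpsi.
have lHt := lbm_shift (t *: e) lH.
rewrite /increment; under eq_Rintegral do rewrite mulrBl.
rewrite RintegralB//; [|lint|lint].
congr (_ - _); last by apply: eq_Rintegral => x _; rewrite scale0r addr0.
rewrite /J -(Rintegral_shift (f := fun x => H x * psi (x + t *: - e)) (t *: e)).
- by apply: eq_Rintegral => x _; rewrite scalerN addrK.
- by apply: lbmM => //; exact: (lbm_shift (f := psi)).
- by apply: bounded_supportMr; exact: (bounded_support_shift (f := psi)).
Qed.

(** This is the derivative of [J] at 0, with the sign coming from the direction [- e]. As no weak
    derivative of [H] is involved, it also applies to the composite function whose weak derivative
    is sought. *)
Lemma increment_quotient_limit H (psi : X -> R^o) (eps : R) :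
  continuous H -> smooth psi -> bounded_support psi -> 0 < eps ->
  \forall t \near 0^'+, `|\int[lam]_x (increment H t x * psi x) +
    t * \int[lam]_x (H x * 'D_e psi x)| <= eps * t.
Proof.
move=> cH spsi bpsi eps0.
have cpsi := smooth_continuous spsi.
have lH := lbm_continuous cH; have lpsi := lbm_continuous cpsi.
have lD := lbm_continuous (smooth_continuous (smooth_derive e spsi)).
have bD := derive_bounded_support e bpsi.
have [dJ JE] := is_derive_convolution (- e) 0 cH spsi bpsi.
have J0 : \int[lam]_x (H x * 'D_(- e) psi (x + 0 *: - e)) =
    - \int[lam]_x (H x * 'D_e psi x).
  rewrite -[RHS]mulN1r -RintegralZl//; last by lint.
  apply: eq_Rintegral => x _.
  rewrite scale0r addr0 deriveNdir; last exact: smooth_differentiable.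
  by rewrite mulrN mulN1r.
rewrite J0 in JE.
have /cvgrPdist_le/(_ _ eps0) := dJ; rewrite -/(derive _ _ _) JE.
rewrite /dnbhs => -[r /= r0 Jr].
exists r => //= t /=; rewrite sub0r normrN => tr t0.
have := Jr t; rewrite /= sub0r normrN => /(_ tr); rewrite gt_eqF// => /(_ isT).
rewrite addr0 [_%:A]mulr1 Rintegral_increment// -/(J H psi t) -/(J H psi 0).
set I := \int[lam]_x (H x * 'D_e psi x).
move=> JI; rewrite (_ : J H psi t - J H psi 0 + t * I =
  - (t * (- I - t^-1 *: (J H psi t - J H psi 0)))); last first.
  by rewrite /GRing.scale/=; field; rewrite gt_eqF.
by rewrite normrN normrM gtr0_norm// mulrC ler_pM2r.
Qed.

End difference_quotient.

(** This keeps the translates of a test function by [s *: e] supported in [U] for all s up to t. *)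
Lemma translate_compact_subset (R : realType) (V : normedModType R) (e : V)
    (U K : set V) : open U -> compact K -> K `<=` U ->
  \forall t \near (0 : R)^'+, K `<=` [set x | forall s, 0 <= s <= t -> U (x + s *: e)].
Proof.
move=> oU /compact_near_coveringP cK KU; apply: cK => x Kx.
have /nbhs_ballP[r /= r0 Ur] : nbhs x U by apply: open_nbhs_nbhs; split=> //; exact: KU.
have r20 : 0 < r / 2 by rewrite divr_gt0.
have e1 : 0 < `|e| + 1 by rewrite ltr_wpDl.
near=> x' t => /= s /andP[s0 st]; apply: Ur.
have xx' : `|x - x'| < r / 2 by near: x'; apply/nbhs_normP; exists (r / 2).
have tr : t < r / 2 / (`|e| + 1).
  by near: t; apply: nbhs_right_lt; rewrite divr_gt0.
rewrite -ball_normE/= (splitr r) opprD addrA (le_lt_trans (ler_normB _ _))// ltrD//.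
rewrite normrZ ger0_norm// (@le_lt_trans _ _ (t * (`|e| + 1)))//.
  by rewrite ler_pM// lerDl.
by rewrite -ltr_pdivlMr.
Unshelve. all: end_near. Qed.

(** * Increments tested against smooth and continuous weights *)

Section weak_increment.
Variables (R : realType) (n : nat) (e : 'rV[R]_n).
Local Notation X := 'rV[R]_n.
Local Notation lam := (@lebesgue_rV R n).
Variables (U K : set X).
Hypotheses (oU : open U) (cK : compact K) (KU : K `<=` U).
Implicit Types psi : X -> R^o.

(** The support is confined to a fixed [K] so that how small t must be depends on [K] alone: this
    allows [forall psi] after [\near], and so the replacement of [psi] by [psi * P]. *)
Definition supported_smooth psi := smooth psi /\ forall x, ~ K x -> psi x = 0.

Lemma supported_smoothM psi (P : X -> R^o) : supported_smooth psi -> smooth P ->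
  supported_smooth (fun x => psi x * P x).
Proof.
move=> [spsi psiK] sP; split; first exact: smoothM.
by move=> x /psiK ->; rewrite mul0r.
Qed.

Variables (v g : X -> R) (M : R).
Hypotheses (cv : continuous v) (mg : measurable_fun setT g).
Hypothesis gM : forall x, `|g x| <= M.
Hypothesis vg : forall psi, test_function U psi ->
  \int[lam]_x (v x * 'D_e psi x) = - \int[lam]_x (g x * psi x).

Local Notation dv := (increment e v).

Let lv := lbm_continuous cv.
Let lg := lbm_bounded mg gM.
Let ldv t := lbm_continuous (continuous_increment (e := e) (t := t) cv).

Let M0 : 0 <= M. Proof. exact: le_trans (normr_ge0 _) (gM 0). Qed.

Let lpsi psi : supported_smooth psi -> locally_bounded_measurable psi.
Proof. by move=> [spsi _]; apply: lbm_continuous; exact: smooth_continuous. Qed.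

Let bpsi psi : supported_smooth psi -> bounded_support psi.
Proof. by move=> [_]; exact: compact_support_bounded. Qed.

(** On [[0, t]] the translate of [psi] is still a test function, so the derivative of [J] at s is
    the integral of [g] times that translate. The mean value theorem and [|g| <= M] conclude. *)
Lemma le_Rintegral_increment_smooth : \forall t \near 0^'+, forall psi,
  supported_smooth psi ->
  `|\int[lam]_x (dv t x * psi x)| <= t * M * \int[lam]_x `|psi x|.
Proof.
near=> t => psi psiS; have [spsi psiK] := psiS.
have lp := lpsi psiS; have bp := bpsi psiS.
have t0 : 0 < t by near: t; exact: nbhs_right_gt.
have KtU : K `<=` [set x | forall s, 0 <= s <= t -> U (x + s *: e)].
  by near: t; exact: (translate_compact_subset _ oU cK KU).
rewrite Rintegral_increment//; last exact: smooth_continuous.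
have dJ (s : R) : 0 <= s <= t -> is_derive s 1
    (fun t : R => \int[lam]_x (v x * psi (x + t *: - e)))
    (\int[lam]_x (g x * psi (x + s *: - e))).
  move=> st; have := is_derive_convolution (- e) s cv spsi bp.
  congr is_derive.
  pose psis x := psi (x + s *: - e).
  have psisT : test_function U psis.
    split; first exact: (smooth_shift (f := psi)).
    exists [set x + s *: e | x in K]; split.
    - apply: continuous_compact => //; apply: continuous_subspaceT.
      exact: shift_continuous.
    - by move=> _ [x Kx <-]; exact: KtU.
    - move=> x xK; apply: psiK => Kx; apply: xK; exists (x + s *: - e) => //.
      by rewrite scalerN subrK.
  rewrite -[RHS]opprK -(vg psisT) -[RHS]mulN1r -RintegralZl//; last first.
    apply: lbm_integrable.
      apply: (lbmM lv); apply: lbm_continuous; apply: smooth_continuous.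
      by apply: smooth_derive; case: psisT.
    apply: bounded_supportMr; apply: derive_bounded_support.
    exact: (bounded_support_shift (f := psi)).
  apply: eq_Rintegral => x _; rewrite deriveNdir; last exact: smooth_differentiable.
  by rewrite derive_shiftr mulN1r mulrN.
have [||c _ ->] := @MVT_segment R (fun t : R => \int[lam]_x (v x * psi (x + t *: - e)))
    (fun s => \int[lam]_x (g x * psi (x + s *: - e))) 0 t (ltW t0).
- by move=> s; rewrite in_itv/= => /andP[s0 st]; apply: dJ; rewrite !ltW.
- apply: derivable_within_continuous => s; rewrite in_itv/= => st.
  by have [] := dJ s st.
rewrite subr0 normrM mulrC (gtr0_norm t0) -mulrA ler_pM2l//.
have lps := lbm_shift (c *: - e) lp; have bps := bounded_support_shift (c *: - e) bp.
rewrite -(Rintegral_shift (f := fun x => `|psi x|) (c *: - e)); [|lbm|bsup].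
rewrite -RintegralZl//; last by lint.
apply: le_norm_Rintegral_lbm; [lbm|bsup|lbm|bsup|].
by move=> x; rewrite normrM ler_wpM2r.
Unshelve. all: end_near. Qed.

Let lsub psi (c : X -> R) (P : X -> R^o) : supported_smooth psi -> continuous c -> smooth P ->
  [/\ locally_bounded_measurable psi, bounded_support psi,
    locally_bounded_measurable c & locally_bounded_measurable P].
Proof.
move=> psiS cc sP; split; [exact: lpsi|exact: bpsi|exact: lbm_continuous|].
by apply: lbm_continuous; exact: smooth_continuous.
Qed.

Let le_eps psi (c : X -> R) (P : X -> R^o) (d : R) : supported_smooth psi ->
  (forall x, K x -> `|c x - P x| <= d) -> forall x,
  `|psi x| * `|c x - P x| <= d * `|psi x|.
Proof.
move=> [_ psiK] cP x; rewrite mulrC.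
have [Kx|/psiK ->] := pselect (K x); last by rewrite normr0 !mulr0.
by rewrite ler_wpM2r// cP.
Qed.

(** For fixed t the approximation of [c] may be refined at will, so the error need not be small
    compared with t. *)
Lemma le_Rintegral_increment : \forall t \near 0^'+, forall psi (c : X -> R),
  supported_smooth psi -> continuous c ->
  `|\int[lam]_x (dv t x * psi x * c x)| <= t * M * \int[lam]_x (`|psi x| * `|c x|).
Proof.
have := le_Rintegral_increment_smooth; apply: filter_app; near=> t => dvs psi c psiS cc.
have t0 : 0 < t by near: t; exact: nbhs_right_gt.
have ldvt := ldv t.
(* The first summand pays for [|P| <= |c| + d] on [K], the second for replacing [c] by [P] under the
   integral. *)
apply: (@ler_of_eps _ _ _ (t * M * \int[lam]_x `|psi x| +
    \int[lam]_x (`|dv t x| * `|psi x|))).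
  by rewrite addr_ge0 ?mulr_ge0 ?(ltW t0)// Rintegral_ge0// => x _; rewrite mulr_ge0.
move=> d d0; have [P sP cP] := smooth_dense cK cc d0.
have [lp bp lc lP] := lsub psiS cc sP.
have le_d := le_eps psiS cP.
have -> : \int[lam]_x (dv t x * psi x * c x) =
    \int[lam]_x (dv t x * (psi x * P x)) + \int[lam]_x (dv t x * psi x * (c x - P x)).
  rewrite -RintegralD//; [|lint|lint].
  by apply: eq_Rintegral => x _; ring.
rewrite (le_trans (ler_normD _ _))// mulrDr addrA lerD//.
  apply: (le_trans (dvs _ (supported_smoothM psiS sP))).
  rewrite [d * _]mulrCA -mulrDr ler_wpM2l ?mulr_ge0 ?(ltW t0)//.
  rewrite -RintegralZl//; last by lint.
  rewrite -RintegralD//; [|lint|lint].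
  apply: le_Rintegral => //; [lint|lint|] => x _.
  rewrite normrM; apply: le_trans (_ : `|psi x| * `|c x| + `|psi x| * `|c x - P x| <= _).
    rewrite -mulrDr ler_wpM2l//.
    by rewrite -[X in `|X|](subrK (c x)) addrC (le_trans (ler_normD _ _))// lerD2l distrC.
  by rewrite lerD2l.
rewrite -RintegralZl//; last by lint.
apply: le_norm_Rintegral_lbm; [lbm|bsup|lbm|bsup|] => x.
by rewrite !normrM -mulrA [leRHS]mulrCA ler_wpM2l.
Unshelve. all: end_near. Qed.

(** The weight is allowed to depend on the increment itself, so it can imitate its sign and turn the
    weak bound into an L1 bound. *)
Lemma le_Rintegral_abs_increment : \forall t \near 0^'+, forall psi,
  supported_smooth psi ->
  \int[lam]_x (`|dv t x| * `|psi x|) <= t * M * \int[lam]_x `|psi x|.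
Proof.
have := le_Rintegral_increment; apply: filter_app; near=> t => dvc psi psiS.
have t0 : 0 < t by near: t; exact: nbhs_right_gt.
have ldvt := ldv t; have lp := lpsi psiS; have bp := bpsi psiS.
have [r psir] := bp.
(* The pointwise estimate [|a| <= a * c + d] loses the constant [d]; [one_r] restricts that loss to
   a set of finite measure. *)
pose one_r : X -> R := \1_[set x : X | `|x| <= r].
have l1 : locally_bounded_measurable one_r.
  apply: (@lbm_bounded _ _ _ 1); last first.
    by move=> x; rewrite /one_r indicE; case: (_ \in _); rewrite ?normr1 ?normr0.
  by apply: measurable_indic; exact: measurable_cube.
have b1 : bounded_support one_r.
  by exists r => x; rewrite ltNge => /negP xr; rewrite /one_r indicE memNset.
apply: (@ler_of_eps _ _ _ (\int[lam]_x one_r x)).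
  by apply: Rintegral_ge0 => x _.
move=> d d0.
(* c = a / (|a| + d) is a continuous approximation of the sign of a *)
pose a x := dv t x * psi x.
have ca : continuous a.
  have cdv := continuous_increment (e := e) (t := t) cv.
  by move=> x; exact: (cvgM (cdv x) (smooth_continuous psiS.1 (x := x))).
pose c x := a x / (`|a x| + d).
have ad x : 0 < `|a x| + d by rewrite ltr_wpDl.
have cc : continuous c.
  move=> x; apply: (cvgM (ca x)); apply: cvgV; first by rewrite gt_eqF.
  exact: (cvgD (cvg_norm (ca x)) (cvg_cst d)).
have lc := lbm_continuous cc.
have c1 x : `|c x| <= 1.
  by rewrite normrM normfV (gtr0_norm (ad x)) ler_pdivrMr// mul1r lerDl ltW.
apply: (@le_trans _ _ (\int[lam]_x (dv t x * psi x * c x) + d * \int[lam]_x one_r x)).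
  rewrite -RintegralZl//; last by lint.
  rewrite -RintegralD//; [|lint|lint].
  apply: le_Rintegral => //; [lint|lint|] => x _.
  rewrite -normrM -/(a x).
  have [xr|rx] := leP `|x| r; last first.
    rewrite /a psir// mulr0 normr0 mul0r add0r /one_r indicE.
    by rewrite mulr_ge0 ?(ltW d0).
  rewrite /one_r indicE mem_set// mulr1 /c mulrA -expr2 -lerBlDr ler_pdivlMr//.
  rewrite -real_normK ?num_real//; nra.
rewrite lerD2r (le_trans (ler_norm _))// (le_trans (dvc _ _ psiS cc))//.
rewrite ler_wpM2l ?mulr_ge0 ?(ltW t0)//.
apply: le_Rintegral => //; [lint|lint|] => x _.
by rewrite ler_piMr.
Unshelve. all: end_near. Qed.

(** Here the approximation error must be small compared with t. The L1 bound on the increment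
    ensures this: replacing [c] by [P] costs at most [d * t * A]. *)
Lemma increment_quotient_weak_limit psi (c : X -> R) (eps : R) :
  supported_smooth psi -> continuous c -> 0 < eps ->
  \forall t \near 0^'+, `|\int[lam]_x (dv t x * psi x * c x) -
    t * \int[lam]_x (g x * psi x * c x)| <= eps * t.
Proof.
move=> psiS cc eps0; have [spsi psiK] := psiS.
pose A := M * \int[lam]_x `|psi x|.
have A0 : 0 <= A by rewrite mulr_ge0// Rintegral_ge0.
(* Two replacements of [c] by [P] cost [eps / 4] each, and the limit for the smooth weight costs
   [eps / 2]; the [+ 1] covers [A = 0]. *)
pose d := eps / 4 / (A + 1).
have A1 : 0 < A + 1 by rewrite ltr_wpDl.
have d0 : 0 < d by rewrite !divr_gt0.
have dA : d * A <= eps / 4 by rewrite /d mulrAC ler_pdivrMr// ler_wpM2l ?lerDl// divr_ge0// ltW.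
have [P sP cP] := smooth_dense cK cc d0.
have psiPS := supported_smoothM psiS sP.
have [lp bp lc lP] := lsub psiS cc sP.
have le_d := le_eps psiS cP.
have eps20 : 0 < eps / 2 by rewrite divr_gt0.
have := increment_quotient_limit e cv psiPS.1 (bpsi psiPS) eps20.
have psiPT : test_function U (fun x => psi x * P x).
  by split; [case: psiPS|exists K; split=> //; case: psiPS].
rewrite vg//.
have := le_Rintegral_abs_increment.
apply: filter_app2; near=> t => /(_ _ psiS) dva dvP.
have t0 : 0 < t by near: t; exact: nbhs_right_gt.
have ldvt := ldv t.
have -> : \int[lam]_x (dv t x * psi x * c x) - t * \int[lam]_x (g x * psi x * c x) =
    \int[lam]_x (dv t x * psi x * (c x - P x)) +
    (\int[lam]_x (dv t x * (psi x * P x)) + t * - \int[lam]_x (g x * (psi x * P x))) -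
    t * \int[lam]_x (g x * psi x * (c x - P x)).
  have -> : \int[lam]_x (dv t x * psi x * c x) =
      \int[lam]_x (dv t x * psi x * (c x - P x)) + \int[lam]_x (dv t x * (psi x * P x)).
    rewrite -RintegralD//; [|lint|lint].
    by apply: eq_Rintegral => x _; ring.
  have -> : \int[lam]_x (g x * psi x * c x) =
      \int[lam]_x (g x * psi x * (c x - P x)) + \int[lam]_x (g x * (psi x * P x)).
    rewrite -RintegralD//; [|lint|lint].
    by apply: eq_Rintegral => x _; ring.
  by ring.
have h1 : `|\int[lam]_x (dv t x * psi x * (c x - P x))| <= eps / 4 * t.
  apply: le_trans (_ : d * (t * A) <= _); last by rewrite mulrCA mulrC ler_pM2r.
  apply: le_trans (_ : d * \int[lam]_x (`|dv t x| * `|psi x|) <= _); last first.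
    by rewrite ler_pM2l// /A mulrA.
  rewrite -RintegralZl//; last by lint.
  apply: le_norm_Rintegral_lbm; [lbm|bsup|lbm|bsup|] => x.
  by rewrite !normrM -mulrA [leRHS]mulrCA ler_wpM2l.
have h2 : `|t * \int[lam]_x (g x * psi x * (c x - P x))| <= eps / 4 * t.
  rewrite normrM (gtr0_norm t0) mulrC ler_pM2r// (le_trans _ dA)// /A mulrA.
  rewrite -RintegralZl//; last by lint.
  apply: le_norm_Rintegral_lbm; [lbm|bsup|lbm|bsup|] => x.
  rewrite !normrM -mulrA (mulrC d) -mulrA.
  by rewrite ler_pM// mulr_ge0.
rewrite (le_trans (ler_normB _ _))//.
apply: le_trans (_ : eps / 4 * t + eps / 2 * t + eps / 4 * t <= _); last by lra.
by rewrite lerD// (le_trans (ler_normD _ _))// lerD.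
Unshelve. all: end_near. Qed.

End weak_increment.

(** * The chain rule *)

Lemma Rintegral_sum d (T : measurableType d) (R : realType)
    (mu : {measure set T -> \bar R}) (D : set T) (I : Type) (s : seq I)
    (P : pred I) (f : I -> T -> R) : measurable D ->
  (forall i, P i -> mu.-integrable D (EFin \o f i)) ->
  \int[mu]_(x in D) (\sum_(i <- s | P i) f i x) =
  \sum_(i <- s | P i) \int[mu]_(x in D) f i x.
Proof.
move=> mD fi; elim: s => [|i s IH].
  rewrite big_nil; under eq_Rintegral do rewrite big_nil.
  by rewrite Rintegral_cst// mul0r.
rewrite big_cons; under eq_Rintegral do rewrite big_cons.
case: ifPn => // Pi; rewrite RintegralD ?IH//; first exact: fi.
rewrite (_ : _ \o _ = (fun x => \sum_(i <- s | P i) (f i x)%:E)%E).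
  exact: integrable_sum.
by apply/funext => x /=; rewrite sumEFin.
Qed.

(** The whole segment from [w x] to [w (x + t *: e)] must be controlled, since the mean value
    theorem evaluates the derivative at an unknown point of it. Uniformity in x comes from covering
    [K]. *)
Lemma near_compact_segment (R : realType) (V W : normedModType R) (K : set V)
    (e : V) (w : V -> W) (D : W -> R) (eps : R) :
  compact K -> continuous w -> continuous D -> 0 < eps ->
  \forall t \near (0 : R)^'+, K `<=` [set x | forall s, 0 <= s <= 1 ->
    `|D (w x + s *: (w (x + t *: e) - w x)) - D (w x)| <= eps].
Proof.
move=> /compact_near_coveringP cK cw cD eps0; apply: cK => x Kx.
have eps20 : 0 < eps / 2 by rewrite divr_gt0.
have /cvgrPdist_lt/(_ _ eps20)/nbhs_normP[r /= r0 Dr] := cD (w x).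
have /cvgrPdist_lt/(_ _ r0)/nbhs_normP[q /= q0 wq] := cw x.
have q20 : 0 < q / 2 by rewrite divr_gt0.
have e1 : 0 < `|e| + 1 by rewrite ltr_wpDl.
near=> x' t => /= s /andP[s0 s1].
have t0 : 0 < t by near: t; exact: nbhs_right_gt.
have xx' : `|x - x'| < q / 2 by near: x'; apply/nbhs_normP; exists (q / 2).
have tq : t < q / 2 / (`|e| + 1).
  by near: t; apply: nbhs_right_lt; rewrite divr_gt0.
have wx' : `|w x - w x'| < r.
  by apply: wq => /=; rewrite (lt_trans xx')// ltr_pdivrMr// ltr_pMr// ltrDl.
have wxt : `|w x - w (x' + t *: e)| < r.
  apply: wq => /=; rewrite opprD addrA (splitr q).
  rewrite (le_lt_trans (ler_normB _ _))// ltrD//.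
  rewrite normrZ gtr0_norm// (@le_lt_trans _ _ (t * (`|e| + 1)))//.
    by rewrite ler_pM2l// lerDl.
  by rewrite -ltr_pdivlMr.
rewrite (splitr eps) (le_trans (ler_distD (D (w x)) _ _))// lerD//.
  rewrite distrC ltW//; apply: Dr => /=.
  have -> : w x - (w x' + s *: (w (x' + t *: e) - w x')) =
      (1 - s) *: (w x - w x') + s *: (w x - w (x' + t *: e)).
    rewrite scalerBl scale1r -addrA -scalerN -scalerDr opprB addrA subrK.
    by rewrite opprD addrA -[in RHS](opprB (w (x' + t *: e))) scalerN.
  have s10 : 0 <= 1 - s by rewrite subr_ge0.
  rewrite (le_lt_trans (ler_normD _ _))// !normrZ !ger0_norm//.
  have [->|s_neq0] := eqVneq s 0; first by rewrite mul0r addr0 subr0 mul1r.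
  have s_gt0 : 0 < s by rewrite lt_neqAle eq_sym s_neq0.
  rewrite [ltRHS](_ : r = (1 - s) * r + s * r); last by ring.
  by rewrite ler_ltD ?ltr_pM2l// ler_wpM2l// ltW.
by rewrite ltW//; apply: Dr.
Unshelve. all: end_near. Qed.

(** One mean value theorem along the segment; the derivative in the direction of the sum then splits
    linearly over the [b i]. *)
Lemma le_increment_directional (R : realType) (W : normedModType R) (I : finType)
    (b : I -> W) (f : W -> R^o) (a : W) (d : I -> R) (eps : R) :
  (forall z, differentiable f z) ->
  (forall i s, 0 <= s <= 1 ->
    `|'D_(b i) f (a + s *: (\sum_i d i *: b i)) - 'D_(b i) f a| <= eps) ->
  `|f (a + \sum_i d i *: b i) - f a - \sum_i d i * 'D_(b i) f a| <=
  eps * \sum_i `|d i|.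
Proof.
move=> df Dle; set v := \sum_i d i *: b i.
have Dv z : 'D_v f z = \sum_i d i * 'D_(b i) f z.
  rewrite deriveE// linear_sum; apply: eq_bigr => i _.
  by rewrite linearZ/= deriveE.
have dl s : is_derive s (1 : R) (fun t : R => f (a + t *: v)) ('D_v f (a + s *: v)).
  exact: is_derive_line.
have fc : {within `[0, 1], continuous (fun t : R => f (a + t *: v))}.
  by apply: derivable_within_continuous => s _; have [] := dl s.
have [c c01] := MVT_segment ler01 (fun s _ => dl s) fc.
move: c01; rewrite in_itv/= => c01.
rewrite scale1r scale0r addr0 subr0 mulr1 => ->.
rewrite Dv -sumrB (le_trans (ler_norm_sum _ _ _))// mulr_sumr ler_sum// => i _.
by rewrite -mulrBr normrM mulrC ler_wpM2r// Dle.
Qed.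

Section chain_rule.
Variables (R : realType) (n : nat) (e : 'rV[R]_n).
Local Notation X := 'rV[R]_n.
Local Notation lam := (@lebesgue_rV R n).

(** The quotients of [f(w)] are known to tend to minus the integral of [f(w)] times the derivative
    of [psi]. The expansion compares them with those of the [u i] weighted by ['D_(b i) f (w x)],
    whose limits are known too. *)
Theorem weak_chain_rule (U : set X) (I : finType) (W : normedModType R)
    (b : I -> W) (u g : I -> X -> R) (M : R) (f : W -> R^o) :
  open U ->
  (forall i, continuous (u i)) -> (forall i, measurable_fun setT (g i)) ->
  (forall i x, `|g i x| <= M) ->
  (forall i psi, test_function U psi ->
    \int[lam]_x (u i x * 'D_e (psi : X -> R^o) x) = - \int[lam]_x (g i x * psi x)) ->
  (forall z, differentiable f z) -> (forall i, continuous ('D_(b i) f)) ->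
  forall psi, test_function U psi ->
    \int[lam]_x (f (\sum_i u i x *: b i) * 'D_e (psi : X -> R^o) x) =
    - \int[lam]_x ((\sum_i 'D_(b i) f (\sum_i u i x *: b i) * g i x) * psi x).
Proof.
move=> oU cu mg gM ug df cDf psi psiT; have [spsi [K [cK KU psiK]]] := psiT.
have psiS : supported_smooth K psi by [].
pose w x := \sum_i u i x *: b i.
have cw : continuous w.
  apply: continuous_big => [|i _ x]; first exact: add_continuous.
  exact: (cvgZr_tmp (a := b i) (cu i x)).
pose H x := f (w x).
have cH : continuous H.
  move=> x; apply: continuous_comp; first exact: cw.
  exact: differentiable_continuous.
pose c i x := 'D_(b i) f (w x).
have cc i : continuous (c i).
  by move=> x; exact: (continuous_comp (cw x) (cDf i (w x))).
have lc i := lbm_continuous (cc i).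
have lH := lbm_continuous cH.
have lg i := lbm_bounded (mg i) (gM i).
have lp := lbm_continuous (smooth_continuous spsi).
have bp := compact_support_bounded cK psiK.
have lDp := lbm_continuous (smooth_continuous (smooth_derive e spsi)).
have bDp := derive_bounded_support e bp.
apply/eqP; rewrite -subr_eq0 opprK -normr_eq0 eq_le normr_ge0 andbT.
pose A := M * \int[lam]_x `|psi x|.
(* In order: the quotient limit for [H], the remainder of the expansion, and the quotient limits for
   the [u i], each divided by t. *)
apply: (@ler_of_eps _ _ _ (1 + #|I|%:R * `|A| + #|I|%:R)).
  by rewrite !addr_ge0// mulr_ge0.
move=> eps eps0; rewrite add0r.
(* A single t serves all estimates; finiteness of [I] lets the quantifier over i pass under
   [\near]. *)
near (0 : R)^'+ => t.
have t0 : 0 < t by near: t; exact: nbhs_right_gt.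
have h1 : `|\int[lam]_x (increment e H t x * psi x) +
    t * \int[lam]_x (H x * 'D_e psi x)| <= eps * t.
  by near: t; exact: increment_quotient_limit.
have h2 i : `|\int[lam]_x (increment e (u i) t x * psi x * c i x) -
    t * \int[lam]_x (g i x * psi x * c i x)| <= eps * t.
  move: i; near: t; apply: filter_forall => i.
  exact: (increment_quotient_weak_limit oU cK KU (cu i) (mg i) (gM i) (ug i)).
have h3 i : \int[lam]_x (`|increment e (u i) t x| * `|psi x|) <= t * A.
  move: i; near: t; apply: filter_forall => i.
  have := le_Rintegral_abs_increment oU cK KU (cu i) (mg i) (gM i) (ug i).
  by apply: filterS => t /(_ _ psiS); rewrite mulrA.
have h4 i : K `<=` [set x | forall s, 0 <= s <= 1 ->
    `|'D_(b i) f (w x + s *: (w (x + t *: e) - w x)) - 'D_(b i) f (w x)| <= eps].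
  by move: i; near: t; apply: filter_forall => i;
    exact: (near_compact_segment e cK cw (cDf i) eps0).
have ldu i := lbm_continuous (continuous_increment (e := e) (t := t) (cu i)).
have ldH := lbm_continuous (continuous_increment (e := e) (t := t) cH).
have -> : \int[lam]_x ((\sum_i c i x * g i x) * psi x) =
    \sum_i \int[lam]_x (g i x * psi x * c i x).
  rewrite -Rintegral_sum// => [|i _]; last by lint.
  by apply: eq_Rintegral => x _; rewrite mulr_suml; apply: eq_bigr => i _; ring.
(* On [K] the remainder is at most eps times the sum of the absolute increments, whose integral
   against [|psi|] is of order t by [h3]; outside [K] everything vanishes. *)
have h5 : `|\int[lam]_x (increment e H t x * psi x) -
    \sum_i \int[lam]_x (increment e (u i) t x * psi x * c i x)| <=
    eps * (#|I|%:R * (t * A)).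
  rewrite -Rintegral_sum// => [|i _]; last by lint.
  have lS : locally_bounded_measurable
      (fun x => \sum_i increment e (u i) t x * psi x * c i x).
    by apply: lbm_sum => i _; lbm.
  have bS : bounded_support (fun x => \sum_i increment e (u i) t x * psi x * c i x).
    by apply: bounded_support_sum => i; bsup.
  rewrite -RintegralB//; [|lint|lint].
  apply: (@le_trans _ _ (\int[lam]_x (\sum_i eps * (`|increment e (u i) t x| * `|psi x|)))).
    have lT : locally_bounded_measurable
        (fun x => \sum_i eps * (`|increment e (u i) t x| * `|psi x|)).
      by apply: lbm_sum => i _; lbm.
    have bT : bounded_support
        (fun x => \sum_i eps * (`|increment e (u i) t x| * `|psi x|)).
      by apply: bounded_support_sum => i; bsup.
    have bST := bounded_supportD (f := fun x => increment e H t x * psi x).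
    apply: le_norm_Rintegral_lbm => //; [lbm| |] => [|x].
      have [r psir] := bp; exists r => x rx.
      rewrite psir// mulr0 big1 ?subr0// => i _; by rewrite mulr0 mul0r.
    have [Kx|/psiK psi0] := pselect (K x); last first.
      rewrite [leRHS]big1 => [|i _]; last by rewrite psi0 normr0 !mulr0.
      rewrite [X in _ - X]big1 => [|i _]; last by rewrite psi0 mulr0 mul0r.
      by rewrite psi0 mulr0 subr0 normr0.
    have wd : w (x + t *: e) - w x = \sum_i increment e (u i) t x *: b i.
      by rewrite /w -sumrB; apply: eq_bigr => i _; rewrite scalerBl.
    have := @le_increment_directional R W I b f (w x)
      (fun i => increment e (u i) t x) eps df _.
    rewrite -wd [w x + _]addrC subrK => Hle.
    rewrite -mulr_sumr -mulr_suml mulrA.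
    rewrite (_ : _ - _ = (increment e H t x -
        \sum_i increment e (u i) t x * c i x) * psi x); last first.
      set p : R := psi x; rewrite [RHS]mulrBl [in RHS]mulr_suml; congr (_ - _).
      by apply: eq_bigr => i _; ring.
    rewrite normrM ler_wpM2r//; apply: Hle => i s s01.
    by have := h4 i x Kx s s01.
  rewrite Rintegral_sum// => [|i _]; last by lint.
  rewrite mulr_natl -sumr_const mulr_sumr; apply: ler_sum => i _.
  by rewrite RintegralZl//; [rewrite ler_pM2l|lint].
rewrite -(ler_pM2l t0) -{1}(gtr0_norm t0) -normrM.
set SI := \sum_i \int[lam]_x (increment e (u i) t x * psi x * c i x) in h5.
set SG := \sum_i \int[lam]_x (g i x * psi x * c i x).
have h6 : `|SI - t * SG| <= #|I|%:R * (eps * t).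
  rewrite mulr_sumr -sumrB (le_trans (ler_norm_sum _ _ _))//.
  by rewrite mulr_natl -sumr_const; apply: ler_sum => i _; exact: h2.
set IH := \int[lam]_x (H x * 'D_e psi x) in h1 *.
set IDH := \int[lam]_x (increment e H t x * psi x) in h1 h5.
rewrite (_ : t * (IH + SG) = (IDH + t * IH) - (IDH - SI) - (SI - t * SG)); last by ring.
rewrite (le_trans (ler_normB _ _))// !mulrDr lerD//; last first.
  by rewrite (le_trans h6)// le_eqVlt; apply/orP; left; apply/eqP; ring.
rewrite (le_trans (ler_normB _ _))// lerD//.
  by rewrite (le_trans h1)// mulr1 mulrC.
rewrite (le_trans h5)// (_ : t * (eps * _) = eps * (#|I|%:R * (t * `|A|))); last by ring.
by rewrite ler_pM2l// ler_wpM2l// ler_pM2l// ler_norm.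
Unshelve. all: end_near. Qed.

End chain_rule.

(** * Occupation measures *)

Lemma continuous_mx (R : realType) (T : topologicalType) m n (f : T -> 'M[R]_(m, n)) :
  (forall i j, continuous (fun x => f x i j)) -> continuous f.
Proof.
move=> cf x; apply/cvg_ballP => e e0; rewrite near_simpl.
have : \forall z \near x, forall i j, ball (f x i j) e (f z i j).
  apply: filter_forall => i; apply: filter_forall => j.
  by have /cvg_ballP/(_ e e0) := cf i j x.
by apply: filterS => z xz; split.
Qed.

Section measurable_pair.
Variables (R : realType) (n p : nat).
Local Notation XY := ('rV[R]_n * 'cV[R]_p)%type.

(** The pair type carries the product sigma-algebra, not a Borel one. Hence [f] is factored through
    the coordinate embedding into a single row vector, where continuous functions are Borel. *)
Lemma measurable_continuous_pair (f : XY -> R) : continuous f ->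
  measurable_fun setT f.
Proof.
move=> cf; pose dec (v : 'rV[R]_(n + p)) : XY := (lsubmx v, (rsubmx v)^T).
have -> : f = (f \o dec) \o @xy_coords R n p.
  apply/funext => -[x y]; rewrite /= /dec /xy_coords/=.
  by rewrite row_mxKl row_mxKr trmxK.
have cl : continuous (fun v : 'rV[R]_(n + p) => lsubmx v).
  apply: continuous_mx => i j; under eq_fun do rewrite mxE.
  exact: coord_continuous.
have cr : continuous (fun v : 'rV[R]_(n + p) => (rsubmx v)^T).
  apply: continuous_mx => i j; under eq_fun do rewrite !mxE.
  exact: coord_continuous.
have cdec : continuous dec by move=> v; exact: (cvg_pair (cl v) (cr v)).
apply: measurableT_comp.
  apply: continuous_measurable_rV => v.
  exact: (continuous_comp (cdec v) (cf (dec v))).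
apply: measurable_fun_mx => i j; rewrite ord1 /xy_coords.
rewrite -(splitK j); case: (fintype.split j) => k /=.
  under eq_fun do rewrite row_mxEl.
  apply: (measurableT_comp (f := fun A : 'rV[R]_n => A 0 k)).
    exact: measurable_coord.
  exact: measurable_fst.
under eq_fun do rewrite row_mxEr mxE.
apply: (measurableT_comp (f := fun A : 'cV[R]_p => A k 0)).
  exact: measurable_coord.
exact: measurable_snd.
Qed.

End measurable_pair.

Section triple_product.
Context d1 d2 d3 (T1 : measurableType d1) (T2 : measurableType d2)
  (T3 : measurableType d3).

Definition measurable_boxes3 : set (set (T1 * T2 * T3)) :=
  [set S | exists A B C, [/\ measurable A, measurable B, measurable C &
    S = A `*` B `*` C]].

Lemma measurable_boxes3E : @measurable _ (T1 * T2 * T3)%type = <<s measurable_boxes3 >>.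
Proof.
apply/seteqP; split; last first.
  apply: smallest_sub; first exact: sigma_algebra_measurable.
  by move=> _ [A [B [C [mA mB mC ->]]]]; apply: measurableX => //; exact: measurableX.
have m1 : measurable_fun setT (fun w : g_sigma_algebraType measurable_boxes3 => w.1.1).
  move=> _ A mA; rewrite setTI; apply: sub_sigma_algebra.
  by exists A, setT, setT; split=> //; apply/seteqP; split=> // -[[a b] c] //= [[]].
have m2 : measurable_fun setT (fun w : g_sigma_algebraType measurable_boxes3 => w.1.2).
  move=> _ B mB; rewrite setTI; apply: sub_sigma_algebra.
  by exists setT, B, setT; split=> //; apply/seteqP; split=> // -[[a b] c] //= [[]].
have m3 : measurable_fun setT (fun w : g_sigma_algebraType measurable_boxes3 => w.2).
  move=> _ C mC; rewrite setTI; apply: sub_sigma_algebra.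
  by exists setT, setT, C; split=> //; apply/seteqP; split=> // -[[a b] c] //= [[]].
have mid : measurable_fun setT
    (fun w : g_sigma_algebraType measurable_boxes3 => (w.1.1, w.1.2, w.2)).
  by apply: measurable_fun_pair => //; exact: measurable_fun_pair.
move=> S mS; have := mid measurableT S mS; rewrite setTI.
rewrite (_ : _ @^-1` S = S)//.
by apply/seteqP; split=> -[[a b] c].
Qed.

Lemma measurable_boxes3I : setI_closed measurable_boxes3.
Proof.
move=> _ _ [A [B [C [mA mB mC ->]]]] [A' [B' [C' [mA' mB' mC' ->]]]].
exists (A `&` A'), (B `&` B'), (C `&` C'); split; [exact: measurableI..|].
by rewrite !setXI.
Qed.

End triple_product.

Section occupation_measure.
Variables (R : realType) (n p : nat).
Local Notation X := 'rV[R]_n.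
Local Notation jet := ('rV[R]_n * 'cV[R]_p * 'M[R]_(p, n))%type.
Variables (mu : {measure set X -> \bar R}) (D : set X).
Variables (y yh : X -> 'cV[R]_p) (Dy Dyh : X -> 'M[R]_(p, n)).
Variables (Y : set 'cV[R]_p) (Z : set 'M[R]_(p, n)).
Variable nu : {measure set jet -> \bar R}.
Hypotheses (mD : measurable D) (Dfin : (mu D < +oo)%E).
Hypotheses (mY : measurable Y) (mZ : measurable Z).
Hypotheses (myh : measurable_fun setT yh) (mDyh : measurable_fun setT Dyh).
Hypothesis yE : {ae mu, forall x, D x -> y x = yh x}.
Hypothesis DyE : {ae mu, forall x, D x -> Dy x = Dyh x}.
Hypothesis yY : {ae mu, forall x, D x -> Y (y x)}.
Hypothesis DyZ : {ae mu, forall x, D x -> Z (Dy x)}.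
Hypothesis nuE : is_occupation_measure mu D y Dy Y Z nu.

Let E := D `*` Y `*` Z.
Let jh x : jet := (x, yh x, Dyh x).

Let mE : measurable E.
Proof. by apply: measurableX => //; exact: measurableX. Qed.

Let mjh : measurable_fun setT jh.
Proof. by apply: measurable_fun_pair => //; exact: measurable_fun_pair. Qed.

Let jhD S : S `<=` E -> jh @^-1` S `<=` D.
Proof. by move=> SE x /SE[[]]. Qed.

Let mjhS S : measurable S -> measurable (jh @^-1` S).
Proof. by move=> mS; rewrite -[X in measurable X]setTI; exact: mjh. Qed.

(** [nu] is prescribed only on boxes inside [E], so both measures are restricted to [E] before
    uniqueness on the pi-system of boxes applies. Their common mass is at most [mu D], which is
    finite. *)
Lemma occupation_measureE S : measurable S -> S `<=` E ->
  nu S = pushforward mu jh S.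
Proof.
pose m2 : {measure set jet -> \bar R} :=
  measure_function_pushforward__canonical__measure_function_Measure mu mjh.
have nu_box A B C : measurable A -> measurable B -> measurable C ->
    A `*` B `*` C `<=` E -> A `<=` D -> B `<=` Y -> C `<=` Z ->
    nu (A `*` B `*` C) = mu (jh @^-1` (A `*` B `*` C)).
  move=> mA mB mC SE AD BY CZ; rewrite nuE//.
  have mS : measurable (A `*` B `*` C).
    by apply: measurableX => //; exact: measurableX.
  rewrite (@ae_eq_integral_nomeas _ _ _ mu D _
      (fun x => (\1_(jh @^-1` (A `*` B `*` C)) x)%:E)).
    by rewrite integral_indic//; [congr (mu _); apply/setIidl/jhD|exact: mjhS].
  by apply: filterS2 yE DyE => x yx Dyx Dx; rewrite yx// Dyx// !indicE.
have boxE A B C : measurable A -> measurable B -> measurable C ->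
    mrestr nu mE (A `*` B `*` C) = mrestr m2 mE (A `*` B `*` C).
  move=> mA mB mC; rewrite /mrestr /= /pushforward /E -!setXI.
  apply: nu_box; try exact: measurableI; try exact: subIsetr.
  by move=> w [[[_ Dw] [_ Yw]] [_ Zw]].
move=> mS SE.
suff : mrestr nu mE S = mrestr m2 mE S by rewrite /mrestr (setIidl SE).
apply: (measure_unique (@measurable_boxes3 _ _ _ _ _ _) (fun=> setT)
  (@measurable_boxes3E _ _ _ _ _ _) (@measurable_boxes3I _ _ _ _ _ _)) => //.
- by move=> _; exists setT, setT, setT; split=> //; rewrite !setXTT.
- by apply/seteqP; split=> // w _; exists 0%N.
- by move=> _ [A [B [C [mA mB mC ->]]]]; exact: boxE.
- move=> _; have := boxE setT setT setT measurableT measurableT measurableT.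
  rewrite !setXTT /mrestr/= !setTI /pushforward => nuEE.
  rewrite /= /mrestr setTI nuEE (le_lt_trans _ Dfin)// le_measure ?inE//; first exact: mjhS.
  exact: jhD.
Qed.

(** The integrand may fail to be Borel on an x-null set; this covers the normal field and the
    piecewise boundary data. *)
Lemma occupation_Rintegral (f fh : jet -> R) : measurable_fun setT fh ->
  {ae mu, forall x, D x -> forall a b, f (x, a, b) = fh (x, a, b)} ->
  \int[nu]_(w in E) f w = \int[mu]_(x in D) f (x, y x, Dy x).
Proof.
move=> mfh [N [mN N0 fN]].
have -> : \int[nu]_(w in E) f w = \int[nu]_(w in E) fh w.
  apply: ae_eq_Rintegral_nomeas.
  (* Since [f] and [fh] agree for all [a], [b] as soon as x avoids [N], the exceptional set is a
     cylinder over [N], which is [nu]-null inside [E]. *)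
  have mNE : measurable (E `&` (fun w => w.1.1) @^-1` N).
    apply: measurableI => //; rewrite -[X in measurable X]setTI.
    by apply: measurableT_comp.
  exists (E `&` (fun w => w.1.1) @^-1` N); split=> //.
    rewrite occupation_measureE//; apply: (subset_measure0 _ mN _ N0).
      exact: mjhS.
    by move=> x [].
  move=> [[x a] b] /= /not_implyP[Ew fw]; split=> //=; apply: fN => /= h.
  by apply: fw; apply: h; case: Ew => -[].
rewrite /Rintegral; congr fine.
rewrite (eq_measure_integral
  (measure_function_pushforward__canonical__measure_function_Measure mu mjh));
  last first.
  by move=> A mA AE; rewrite occupation_measureE.
have mfhE : measurable_fun E (EFin \o fh).
  by apply/measurable_EFinP; exact: measurable_funTS.
transitivity (\int[mu]_(x in jh @^-1` E) (fh (jh x))%:E)%E.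
  rewrite integralE [RHS]integralE; congr (_ - _)%E.
    rewrite ge0_integral_pushforward//; last exact: measurable_funepos.
    by apply: eq_integral => x _; rewrite /= !funeposE.
  rewrite ge0_integral_pushforward//; last exact: measurable_funeneg.
  by apply: eq_integral => x _; rewrite /= !funenegE.
(* The preimage of [E] differs from [D] only where y leaves [Y] or Dy leaves [Z], up to a null set:
   again a null set. *)
rewrite [LHS]integral_mkcond [RHS]integral_mkcond.
apply: ae_eq_integral_nomeas.
have fae : {ae mu, forall x, D x -> forall a b, f (x, a, b) = fh (x, a, b)}.
  by exists N.
apply: filterS (filterI (filterI yE DyE) (filterI (filterI yY DyZ) fae)) => x
  [[yx Dyx] [[Yx Zx] fx]] _.
rewrite !patchE; have [xD|xD] := boolP (x \in D).
  have Dx := set_mem xD.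
  rewrite mem_set; first by rewrite fx// yx// Dyx.
  by split; [split => //=; rewrite -yx//; exact: Yx|rewrite /= -Dyx//; exact: Zx].
by rewrite memNset// => /(@jhD E (@subset_refl _ _)) Dx; rewrite mem_set in xD.
Qed.

End occupation_measure.

(** * The divergence theorem along the graph *)

Section linear_change.
Variables (R : realType) (V W : normedModType R) (L : {linear V -> W}).
Implicit Types f : W -> R^o.

Lemma derive_comp_linear f v x : 'D_v (f \o L) x = 'D_(L v) f (L x).
Proof.
by rewrite /derive /=; under eq_fun do rewrite linearP.
Qed.

Lemma smooth_comp_linear f : continuous L -> smooth f -> smooth (f \o L).
Proof.
move=> cL fs s x.
have -> : iter_derive s (f \o L) = iter_derive (map L s) f \o L.
  by elim: s => //= v s ->; apply/funext => z; exact: derive_comp_linear.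
apply: differentiable_comp; first exact: linear_differentiable.
exact: fs.
Qed.

End linear_change.

Section weak_partial_global.
Variables (R : realType) (n : nat).
Local Notation X := 'rV[R]_n.
Local Notation lam := (@lebesgue_rV R n).
Implicit Types (U Omega : set X) (u g : X -> R).

Lemma open_measurable_rV U : open U -> measurable U.
Proof. exact: sub_sigma_algebra. Qed.

Lemma closed_measurable_rV U : closed U -> measurable U.
Proof.
move=> cU; rewrite -(setCK U); apply: measurableC.
by apply: open_measurable_rV; exact: closed_openC.
Qed.

Lemma Linfty_regular U u : measurable U -> Linfty U u ->
  exists g M, [/\ measurable_fun setT g, forall x, `|g x| <= M &
    {ae lam, forall x, U x -> u x = g x}].
Proof.
move=> mU [[g mg ug] [M uM]].
pose N := `|M|.
(* Clipping to [[-N, N]] turns the almost everywhere bound into an everywhere bound. *)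
pose h x := Num.max (- N) (Num.min N ((g \_ U) x)).
have N0 : 0 <= N by exact: normr_ge0.
exists h, N; split.
- apply: measurable_maxr; first exact: measurable_cst.
  apply: measurable_minr; first exact: measurable_cst.
  by apply/measurable_restrict => //; rewrite setTI.
- by move=> x; rewrite ler_norml /h le_max lexx/= ge_max ge_min lexx/= andbT ge0_cp.
apply: filterS2 ug uM => x ug uM Ux.
rewrite /h patchE mem_set// -ug//.
have : `|u x| <= N by rewrite (le_trans (uM Ux))// ler_norm.
by rewrite ler_norml => /andP[Nu uN]; rewrite min_r// max_r.
Qed.

Lemma Rintegral_supported U u : (forall x, ~ U x -> u x = 0) ->
  \int[lam]_(x in U) u x = \int[lam]_x u x.
Proof.
move=> u0; rewrite Rintegral_mkcond; apply: eq_Rintegral => x _.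
by rewrite patchE; case: ifPn => // xU; rewrite u0//; move: xU; rewrite notin_setE.
Qed.

(** Test functions vanish outside a compact subset of [U], so integrals over [U] may be taken over
    the whole space, where translations act, with any extensions of [u] and [g]. *)
Lemma weak_partial_globalP U m u g uh gh :
  (forall x, U x -> u x = uh x) -> {ae lam, forall x, U x -> g x = gh x} ->
  weak_partial U m u g <->
  forall psi, test_function U psi ->
    \int[lam]_x (uh x * 'D_(delta_mx 0 m) (psi : X -> R^o) x) =
    - \int[lam]_x (gh x * psi x).
Proof.
move=> uuh ggh.
have H psi : test_function U psi ->
    \int[lam]_(x in U) (u x * 'D_(delta_mx 0 m) (psi : X -> R^o) x) =
    \int[lam]_x (uh x * 'D_(delta_mx 0 m) (psi : X -> R^o) x) /\
    \int[lam]_(x in U) (g x * psi x) = \int[lam]_x (gh x * psi x).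
  move=> [spsi [K [cK KU psiK]]]; split.
    rewrite -(@Rintegral_supported U (fun x => uh x * _)); last first.
      move=> x Ux; rewrite (derive_out_compact _ cK psiK) ?mulr0//.
      by move=> /KU.
    by apply: eq_Rintegral => x /set_mem Ux; rewrite uuh.
  rewrite -(@Rintegral_supported U (fun x => gh x * _)); last first.
    by move=> x Ux; rewrite psiK ?mulr0// => /KU.
  by apply: ae_eq_Rintegral_nomeas; apply: filterS ggh => x gx Ux; rewrite gx.
split=> h psi psiT; have := h psi psiT; have [-> ->] := H psi psiT; exact.
Qed.

(** The integral of a translate of [psi] does not depend on the translation; its derivative is this
    integral. *)
Lemma Rintegral_derive_bounded_support (psi : X -> R^o) (w : X) :
  smooth psi -> bounded_support psi -> \int[lam]_x 'D_w psi x = 0.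
Proof.
move=> spsi bpsi.
have c1 : continuous (cst 1 : X -> R) by exact: cst_continuous.
have lpsi := lbm_continuous (smooth_continuous spsi).
have [_] := is_derive_convolution w 0 c1 spsi bpsi.
rewrite (_ : (fun t : R => _) = cst (\int[lam]_x psi x)); last first.
  apply/funext => t /=; rewrite -(Rintegral_shift (t *: w) lpsi bpsi).
  by apply: eq_Rintegral => x _; rewrite mul1r.
rewrite derive_cst => h; rewrite [RHS]h.
by apply: eq_Rintegral => x _; rewrite mul1r scale0r addr0.
Qed.

Lemma smooth_coord k : smooth (fun x : X => x 0 k : R^o).
Proof.
apply: smooth_linear; last exact: coord_continuous.
by move=> a u v; rewrite !mxE.
Qed.

(** The explicit dependence of [phi] on x is handled by counting the coordinates of x among the
    [u i] of the chain rule. *)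
Lemma weak_partial_coord U k m (psi : X -> R^o) : test_function U psi ->
  \int[lam]_x (x 0 k * 'D_(delta_mx 0 m) psi x) = - \int[lam]_x ((k == m)%:R * psi x).
Proof.
move=> [spsi [K [cK KU psiK]]].
have bpsi := compact_support_bounded cK psiK.
have sk := smooth_coord k.
have := @Rintegral_derive_bounded_support _ (delta_mx 0 m)
  (smoothM sk spsi) (bounded_supportMr _ bpsi).
have lp := lbm_continuous (smooth_continuous spsi).
have lk := lbm_continuous (smooth_continuous sk).
have lD := lbm_continuous (smooth_continuous (smooth_derive (delta_mx 0 m) spsi)).
have bD := derive_bounded_support (delta_mx 0 m) bpsi.
have DE x : 'D_(delta_mx 0 m) (fun x : X => x 0 k * psi x : R^o) x =
    x 0 k * 'D_(delta_mx 0 m) psi x + (k == m)%:R * psi x.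
  rewrite (@deriveM _ _ (fun x : X => x 0 k : R^o) psi); last 2 first.
  - by apply: diff_derivable; exact: smooth_differentiable.
  - by apply: diff_derivable; exact: smooth_differentiable.
  congr (_ + _); rewrite [RHS]mulrC; congr (_ * _).
  rewrite derive_linear ?mxE ?eqxx//; last exact: coord_continuous.
  by move=> a u v; rewrite !mxE.
under eq_Rintegral do rewrite DE.
rewrite RintegralD//; first by move=> /eqP; rewrite addr_eq0 => /eqP.
  apply: lbm_integrable; first exact: lbmM.
  exact: bounded_supportMr.
apply: lbm_integrable; last exact: bounded_supportMr.
by apply: lbmM => //; exact: lbm_cst.
Qed.

End weak_partial_global.

Section continuous_extension.
Variables (R : realType) (V : normedModType R) (K : set V).
Hypothesis cK : compact K.

Let clK : closed K.
Proof. by apply: compact_closed => //; exact: norm_hausdorff. Qed.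

(** Tietze's theorem; the extension is needed because increments evaluate the function at translated
    points, possibly outside [K]. *)
Lemma continuous_extension (f : V -> R) : {within K, continuous f} ->
  exists2 g : V -> R, continuous g & forall x, K x -> f x = g x.
Proof.
move=> cf.
have /compact_bounded[M [_ MK]] := continuous_compact cf cK.
have M0 : 0 < `|M| + 1 by rewrite ltr_wpDl.
have fM x : K x -> `|f x| <= `|M| + 1.
  move=> Kx; apply: (MK (`|M| + 1)); last by exists x.
  by rewrite (le_lt_trans (ler_norm _))// ltrDl.
have [g [fg cg _]] :=
  continuous_bounded_extension (@pseudometric_normal R V) clK M0 cf fM.
by exists g => // x Kx; apply: fg; exact: mem_set.
Qed.

Lemma continuous_extension_mx m n (f : V -> 'M[R]_(m, n)) :
  {within K, continuous f} ->
  exists2 g : V -> 'M[R]_(m, n), continuous g & forall x, K x -> f x = g x.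
Proof.
move=> cf.
have H i j : exists2 g : V -> R, continuous g & forall x, K x -> f x i j = g x.
  apply: continuous_extension => x.
  exact: (continuous_comp (cf x) (@coord_continuous _ _ _ i j (f x))).
pose g i j := projT1 (cid2 (H i j)).
exists (fun x => \matrix_(i, j) g i j x).
  apply: continuous_mx => i j; under eq_fun do rewrite mxE.
  by rewrite /g; case: cid2.
move=> x Kx; apply/matrixP => i j; rewrite mxE /g; case: cid2 => /= h _ fh.
exact: fh.
Qed.

End continuous_extension.

Section gauss_green_chain.
Variables (R : realType) (n : nat).
Local Notation X := 'rV[R]_n.
Local Notation lam := (@lebesgue_rV R n).
Variables (Omega : set X) (sigma : {finite_measure set X -> \bar R}) (eta : X -> X).
Hypotheses (cO : compact Omega) (SD : surface_data Omega sigma eta).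

Let clO : closed Omega.
Proof. by apply: compact_closed => //; exact: norm_hausdorff. Qed.

Let mO : measurable Omega.
Proof. exact: closed_measurable_rV. Qed.

Let mOi : measurable Omega°.
Proof. by apply: open_measurable_rV; exact: open_interior. Qed.

Lemma measurable_boundary : measurable (boundary Omega).
Proof.
by apply: measurableD => //; apply: closed_measurable_rV; exact: closed_closure.
Qed.

Lemma boundary_subset : boundary Omega `<=` Omega.
Proof. by move=> x []; rewrite -(closure_id _).1. Qed.

Lemma subset_boundaryU x : Omega x -> Omega° x \/ boundary Omega x.
Proof.
move=> Ox; have [|Oix] := pselect (Omega° x); [by left|right].
by split=> //; exact: subset_closure.
Qed.

Lemma compact_cube_subset : exists r : R, Omega `<=` [set x | `|x| <= r].
Proof.
have [M [_ MK]] := compact_bounded cO; exists (`|M| + 1) => x Ox.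
by apply: (MK (`|M| + 1)) => //; rewrite (le_lt_trans (ler_norm _))// ltrDl.
Qed.

Lemma lebesgue_compact_lty : (lam Omega < +oo)%E.
Proof.
have [r Or] := compact_cube_subset.
apply: le_lt_trans (lebesgue_rV_cube_lty n r).
by rewrite le_measure ?inE//; exact: measurable_cube.
Qed.

Lemma lbm_integrable_compact f : locally_bounded_measurable f ->
  lam.-integrable Omega (EFin \o f).
Proof.
move=> [mf bf]; have [r Or] := compact_cube_subset.
apply: measurable_bounded_integrable => //.
- exact: lebesgue_compact_lty.
- exact: measurable_funTS.
have [M fM] := bf r; exists M; split; rewrite ?num_real// => N MN x /= Ox.
by rewrite (le_trans (fM _ (Or _ Ox)))// ltW.
Qed.

Lemma lbm_Linfty f : locally_bounded_measurable f -> Linfty Omega° f.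
Proof.
move=> [mf bf]; have [r Or] := compact_cube_subset; split.
  by exists f; [exact: measurable_funTS|apply: aeW].
have [M fM] := bf r; exists M; apply: aeW => x /interior_subset Ox.
exact: fM (Or _ Ox).
Qed.

(* The divergence theorem for h = 0, whose weak derivative may be given any
   values on the boundary. *)
Lemma boundary_null : lam (boundary Omega) = 0%E.
Proof.
have mB := measurable_boundary.
(* In dimension 0 there is no direction in which to apply the divergence theorem, but a one-point
   space has no boundary. *)
case: (posnP n) => [n0|n_gt0].
  suff -> : boundary Omega = set0 by rewrite measure0.
  apply/seteqP; split=> // x Bx; case: (Bx) => _; apply.
  apply: filterS (filterT : nbhs x setT) => z _.
  rewrite (_ : z = x); first exact: boundary_subset.
  by apply/rowP => -[i ilt]; exfalso; move: ilt; rewrite n0.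
pose m : 'I_n := Ordinal n_gt0.
pose dh : X -> R := \1_(boundary Omega).
have l0 : Linfty Omega° (cst 0 : X -> R) by apply: lbm_Linfty; exact: lbm_cst.
have wp0 m' g : (forall x, Omega° x -> g x = 0) ->
    weak_partial Omega° m' (cst 0 : X -> R) g.
  move=> g0; apply/(@weak_partial_globalP _ _ _ _ _ _ (cst 0) (cst 0)) => //.
    exact: aeW.
  move=> psi _; under eq_Rintegral do rewrite mul0r.
  by under [in RHS]eq_Rintegral do rewrite mul0r; rewrite Rintegral_cst// mul0r oppr0.
have := @gauss_green _ _ _ _ _ SD m (cst 0) dh.
have -> : \int[sigma]_(x in boundary Omega) ((cst 0 : X -> R) x * eta x 0 m) = 0.
  by under eq_Rintegral do rewrite mul0r; rewrite Rintegral_cst// mul0r.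
move=> H; have {H} : 0 = \int[lam]_(x in Omega) dh x.
  apply: H.
  - by apply: continuous_subspaceT; exact: cst_continuous.
  - by split=> // m'; exists (cst 0); [exact: wp0|split].
  - by apply: wp0 => x Ox; rewrite /dh indicE memNset// => -[].
  - apply: lbm_Linfty; apply: (@lbm_bounded _ _ _ 1); first exact: measurable_indic.
    by move=> x; rewrite /dh indicE; case: (_ \in _); rewrite ?normr1 ?normr0.
rewrite /Rintegral integral_indic// (setIidl boundary_subset) => /esym/eqP.
rewrite fine_eq0; first by move=> /eqP.
rewrite ge0_fin_numE// (le_lt_trans _ lebesgue_compact_lty)// le_measure ?inE//.
exact: boundary_subset.
Qed.

Lemma ae_interior (P : X -> Prop) : {ae lam, forall x, Omega° x -> P x} ->
  {ae lam, forall x, Omega x -> P x}.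
Proof.
move=> OP.
have Bnull : {ae lam, forall x, ~ boundary Omega x}.
  exists (boundary Omega); split; [exact: measurable_boundary|exact: boundary_null|].
  by move=> x /= /contrapT.
by apply: filterS2 OP Bnull => x OP nB /subset_boundaryU[/OP|/nB].
Qed.

(** The chain rule in every direction puts [f(w)] in W^(1,oo), and continuity makes it its own
    boundary trace, so the divergence theorem applies to it. *)
Lemma gauss_green_chain (I : finType) (W : normedModType R) (b : I -> W)
    (u : I -> X -> R) (g : 'I_n -> I -> X -> R) (M : R) (f : W -> R^o) :
  (forall i, continuous (u i)) -> (forall m i, measurable_fun setT (g m i)) ->
  (forall m i x, `|g m i x| <= M) ->
  (forall m i psi, test_function Omega° psi ->
    \int[lam]_x (u i x * 'D_(delta_mx 0 m) (psi : X -> R^o) x) =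
    - \int[lam]_x (g m i x * psi x)) ->
  smooth f -> forall m,
  \int[sigma]_(x in boundary Omega) (f (\sum_i u i x *: b i) * eta x 0 m) =
  \int[lam]_(x in Omega) 'D_(\sum_i g m i x *: b i) f (\sum_i u i x *: b i).
Proof.
move=> cu mg gM ug sf m.
pose w x := \sum_i u i x *: b i.
pose h x := f (w x).
pose dh m x := \sum_i 'D_(b i) f (w x) * g m i x.
have cw : continuous w.
  apply: continuous_big => [|i _ x]; first exact: add_continuous.
  exact: (cvgZr_tmp (a := b i) (cu i x)).
have cD i : continuous ('D_(b i) f) by apply: smooth_continuous; exact: smooth_derive.
have ch : continuous h.
  by move=> x; exact: (continuous_comp (cw x) (smooth_continuous sf (x := w x))).
have lh := lbm_continuous ch.
have ldh m' : locally_bounded_measurable (dh m').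
  apply: lbm_sum => i _; apply: lbmM; last exact: (lbm_bounded (mg m' i) (gM m' i)).
  by apply: lbm_continuous => x; exact: (continuous_comp (cw x) (cD i (w x))).
have wh m' : weak_partial Omega° m' h (dh m').
  apply/(@weak_partial_globalP _ _ _ _ _ _ h (dh m')) => //; first exact: aeW.
  apply: (weak_chain_rule _ cu (mg m') (gM m') (ug m')) => //.
    exact: open_interior.
  by move=> z; exact: smooth_differentiable.
rewrite (@gauss_green _ _ _ _ _ SD m h (dh m)).
- apply: eq_Rintegral => x _; rewrite deriveE ?linear_sum; last exact: smooth_differentiable.
  apply: eq_bigr => i _; rewrite linearZ/= deriveE 1?mulrC//.
  exact: smooth_differentiable.
- exact: continuous_subspaceT.
- split; first exact: lbm_Linfty.
  by move=> m'; exists (dh m') => //; split=> //; exact: lbm_Linfty.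
- exact: wh.
- exact: lbm_Linfty.
Qed.

End gauss_green_chain.

(** * Borel representatives of the data *)

Section regular_versions.
Variables (R : realType) (n : nat).
Local Notation X := 'rV[R]_n.

Lemma Linfty_regular_fin (U : set X) (I : finType) (u : I -> X -> R) :
  measurable U -> (forall i, Linfty U (u i)) ->
  exists (g : I -> X -> R) (M : R), [/\ forall i, measurable_fun setT (g i),
    forall i x, `|g i x| <= M
    & {ae @lebesgue_rV R n, forall x, U x -> forall i, u i x = g i x}].
Proof.
move=> mU Lu; have /choice[g /choice[M gM]] : forall i, exists (g : X -> R) (M : R),
    [/\ measurable_fun setT g, forall x, `|g x| <= M
    & {ae @lebesgue_rV R n, forall x, U x -> u i x = g x}].
  by move=> i; exact: Linfty_regular.
exists g, (\sum_i `|M i|); split=> [i|i x|].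
- by have [] := gM i.
- have [_ /(_ x) gMx _] := gM i; rewrite (bigD1 i)//=.
  rewrite (le_trans gMx)// (le_trans (ler_norm _))// lerDl.
  exact: sumr_ge0.
have : {ae @lebesgue_rV R n, forall x i, U x -> u i x = g i x}.
  by apply: filter_forall => i; have [] := gM i.
by apply: filterS => x ug Ux i; exact: ug.
Qed.

Lemma completion_regular (mu : {measure set X -> \bar R}) (D : set X) a b
    (f : X -> 'M[R]_(a, b)) : measurable D -> measurable_fun_completion mu D f ->
  exists2 g, measurable_fun setT g & {ae mu, forall x, D x -> f x = g x}.
Proof.
move=> mD [g mg fg]; exists (fun x => \matrix_(i, j) ((fun x => g x i j) \_ D) x).
  apply: measurable_fun_mx => i j; under eq_fun do rewrite mxE.
  apply/measurable_restrict => //; rewrite setTI.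
  exact: (measurableT_comp (@measurable_coord _ _ _ i j)).
apply: filterS fg => x fg Dx; rewrite fg//.
by apply/matrixP => i j; rewrite mxE patchE mem_set.
Qed.

Lemma measurable_basic_semialgebraic N (g : 'I_N -> mpoly.mpoly n R) :
  measurable (basic_semialgebraic g).
Proof.
rewrite (_ : basic_semialgebraic g = \bigcap_(i in [set: 'I_N])
    ((fun x : X => mpoly.meval (x 0) (g i)) @^-1` `[0, +oo[)); last first.
  apply/seteqP; split=> x gx i => [_|]; first by rewrite /= in_itv/= andbT; exact: gx.
  by have := gx i Logic.I; rewrite /= in_itv/= andbT.
apply: fin_bigcap_measurable => // i _; rewrite -[X in measurable X]setTI.
suff mP : measurable_fun setT (fun x : X => mpoly.meval (x 0) (g i)).
  by apply: mP => //; exact: measurable_itv.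
apply: (@polynomial_in_closed _ _ _ (@id X) (fun f => measurable_fun setT f)) => //.
- by move=> f h; exact: measurable_funD.
- by move=> f h; exact: measurable_funM.
- by move=> j; exact: measurable_coord.
by exists (g i).
Qed.

End regular_versions.

(** * Measurability and total derivatives on the space of jets *)

Section jets.
Variables (R : realType) (n p : nat).
Local Notation X := 'rV[R]_n.
Local Notation XY := ('rV[R]_n * 'cV[R]_p)%type.
Local Notation jet := ('rV[R]_n * 'cV[R]_p * 'M[R]_(p, n))%type.

Lemma measurable_jet_entry l m : measurable_fun setT (fun w : jet => w.2 l m).
Proof. exact: (measurableT_comp (@measurable_coord _ _ _ l m)). Qed.

Lemma measurable_polynomial_jet (P : jet -> R) :
  polynomial_in (@jet_coords R n p) P -> measurable_fun setT P.
Proof.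
apply: (@polynomial_in_closed _ _ _ _ (fun f => measurable_fun setT f)) => //.
- by move=> f h; exact: measurable_funD.
- by move=> f h; exact: measurable_funM.
move=> i; rewrite /jet_coords /xy_coords -(splitK i).
case: (fintype.split i) => {}i /=.
  under eq_fun do rewrite row_mxEl.
  rewrite -(splitK i); case: (fintype.split i) => {}i /=.
    under eq_fun do rewrite row_mxEl.
    apply: (measurableT_comp (@measurable_coord _ _ _ 0 i)).
    exact: measurableT_comp.
  under eq_fun do rewrite row_mxEr mxE.
  apply: (measurableT_comp (@measurable_coord _ _ _ i 0)).
  exact: measurableT_comp.
under eq_fun do rewrite row_mxEr.
case/mxvec_indexP: i => l m; under eq_fun do rewrite mxvecE.
exact: measurable_jet_entry.
Qed.

Lemma piecewise_measurable (mu : {measure set X -> \bar R}) (I : finType)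
    (S : I -> set X) (G : jet -> R) : (forall i, measurable (S i)) ->
  (forall i, exists2 P, measurable_fun setT P &
    {ae mu, forall x, S i x -> forall a b, G (x, a, b) = P (x, a, b)}) ->
  exists2 Gh, measurable_fun setT Gh &
    {ae mu, forall x, (\bigcup_i S i) x -> forall a b, G (x, a, b) = Gh (x, a, b)}.
Proof.
move=> mS GP.
suff H (s : seq I) : exists2 Gh, measurable_fun setT Gh &
    {ae mu, forall x, (exists2 i, i \in s & S i x) ->
      forall a b, G (x, a, b) = Gh (x, a, b)}.
  have [Gh mGh GhE] := H (index_enum I); exists Gh => //.
  apply: filterS GhE => x GhE [i _ Six].
  by apply: GhE; exists i => //; exact: mem_index_enum.
elim: s => [|i s [Gh mGh GhE]].
  by exists (cst 0) => //; apply: aeW => x [].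
have [P mP PE] := GP i.
pose in_S (w : jet) : R := \1_(S i) w.1.1.
have min_S : measurable_fun setT in_S.
  apply: (measurableT_comp (f := (\1_(S i) : X -> R))).
    exact: measurable_indic.
  exact: measurableT_comp.
(* Pieces may overlap: on an overlap every representative agrees almost everywhere with [G], so the
   order of selection is harmless. *)
exists (fun w => in_S w * P w + (1 - in_S w) * Gh w).
  apply: measurable_funD; apply: measurable_funM => //.
  exact: measurable_funB.
apply: filterS2 GhE PE => x GhE PE [j]; rewrite inE /in_S/= indicE.
have [/set_mem Six _ _ a b|xS] := boolP (x \in S i).
  by rewrite mul1r subrr mul0r addr0; exact: PE.
move=> /predU1P[-> Six|js Sjx a b]; first by move: xS; rewrite notin_setE.
by rewrite mulr0n mul0r add0r subr0 mul1r; apply: GhE; exists j.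
Qed.

Lemma smooth_fst_coord j : smooth (fun w : XY => w.1 0 j : R^o).
Proof.
apply: smooth_linear => [a u v|w]; first by rewrite /= !mxE.
exact: (continuous_comp (@cvg_fst _ _ _ _ _) (@coord_continuous _ _ _ 0 j w.1)).
Qed.

Lemma smooth_snd_coord i : smooth (fun w : XY => w.2 i 0 : R^o).
Proof.
apply: smooth_linear => [a u v|w]; first by rewrite /= !mxE.
exact: (continuous_comp (@cvg_snd _ _ _ _ _) (@coord_continuous _ _ _ i 0 w.2)).
Qed.

Lemma smooth_polynomial_xy (f : XY -> R^o) :
  polynomial_in (@xy_coords R n p) f -> smooth f.
Proof.
apply: (@polynomial_in_closed _ _ _ _ (fun f => smooth (f : XY -> R^o))).
- by move=> a; exact: smooth_cst.
- by move=> g h; exact: smoothD.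
- by move=> g h; exact: smoothM.
move=> i; rewrite /xy_coords -(splitK i); case: (fintype.split i) => {}i /=.
  by under eq_fun do rewrite row_mxEl; exact: smooth_fst_coord.
by under eq_fun do rewrite row_mxEr mxE; exact: smooth_snd_coord.
Qed.

(** The total derivative is one directional derivative, along the tangent of the graph with slope
    [z]; the product rule and the link with the chain rule follow. *)
Lemma total_derivativeE (f : XY -> R^o) m (w : jet) : smooth f ->
  total_derivative f m w = 'D_((delta_mx 0 m, col m w.2) : XY) f w.1.
Proof.
move=> sf; have df z := smooth_differentiable z sf.
have -> : ((delta_mx 0 m, col m w.2) : XY) =
    (delta_mx 0 m, 0) + \sum_(l < p) w.2 l m *: (0, delta_mx l 0).
  have -> : \sum_(l < p) w.2 l m *: ((0, delta_mx l 0) : XY) = (0, col m w.2).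
    rewrite [col m w.2]matrix_sum_delta.
    rewrite [LHS]surjective_pairing; congr (_, _).
      rewrite (raddf_sum (@fst _ _)) big1// => l _ /=; exact: scaler0.
    rewrite (raddf_sum (@snd _ _)); apply: eq_bigr => l _.
    by rewrite big_ord1 mxE.
  by congr (_, _); rewrite ?addr0 ?add0r.
rewrite deriveE// linearD linear_sum /total_derivative deriveE//; congr (_ + _).
by apply: eq_bigr => l _; rewrite linearZ/= deriveE.
Qed.

Lemma total_derivativeM (f g : XY -> R^o) m (w : jet) : smooth f -> smooth g ->
  total_derivative (fun v => f v * g v : R^o) m w =
  f w.1 * total_derivative g m w + g w.1 * total_derivative f m w.
Proof.
move=> sf sg; rewrite !total_derivativeE//; last exact: smoothM.
by rewrite deriveM//; apply: diff_derivable; exact: smooth_differentiable.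
Qed.

Lemma measurable_total_derivative (f : XY -> R^o) m : smooth f ->
  measurable_fun setT (total_derivative f m : jet -> R).
Proof.
move=> sf; have mD v : measurable_fun setT (fun w : jet => 'D_v f w.1 : R).
  apply: (measurableT_comp (f := fun z : XY => 'D_v f z : R)) => //.
  apply: measurable_continuous_pair; apply: smooth_continuous.
  exact: smooth_derive.
apply: measurable_funD => //; apply: measurable_sum => l.
by apply: measurable_funM => //; exact: measurable_jet_entry.
Qed.

Lemma measurable_smooth_jet (f : XY -> R^o) : smooth f ->
  measurable_fun setT (fun w : jet => f w.1 : R).
Proof.
move=> sf; apply: (measurableT_comp (f := fun z : XY => f z : R)) => //.
by apply: measurable_continuous_pair; exact: smooth_continuous.
Qed.

Lemma total_derivative_entry q r (B : XY -> 'M[R]_(q, r)) m (w : jet) i j :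
  (forall i j, smooth (fun z => B z i j : R^o)) ->
  total_derivative B m w i j = total_derivative (fun z => B z i j : R^o) m w.
Proof.
move=> sB; have dB v : derivable B w.1 v.
  apply/derivable_mxP => a b; apply: diff_derivable; apply: smooth_differentiable.
  exact: sB.
rewrite /total_derivative !mxE summxE derive_mx// mxE; congr (_ + _).
by apply: eq_bigr => l _; rewrite !mxE derive_mx// mxE.
Qed.

Lemma lbm_total_derivative (f : XY -> R^o) m (y : X -> 'cV[R]_p)
    (z : X -> 'M[R]_(p, n)) (M : R) : smooth f -> continuous y ->
  (forall l m, measurable_fun setT (fun x => z x l m)) ->
  (forall l m x, `|z x l m| <= M) ->
  locally_bounded_measurable (fun x => total_derivative f m (x, y x, z x)).
Proof.
move=> sf cy mz zM.
have lD v : locally_bounded_measurable (fun x => 'D_v f (x, y x)).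
  apply: lbm_continuous => x.
  exact: (continuous_comp (cvg_pair cvg_id (cy x))
    (smooth_continuous (smooth_derive v sf) (x := (x, y x)))).
apply: lbmD => //; apply: lbm_sum => l _; apply: lbmM => //.
exact: (lbm_bounded (mz l m) (zM l m)).
Qed.

End jets.

(** * The divergence theorem for functions of position, y and a column of Dy *)

Section coordinates.
Variables (R : realType) (n p : nat).
Local Notation XY := ('rV[R]_n * 'cV[R]_p)%type.
Local Notation XYC := (XY * 'cV[R]_p)%type.

Definition xy_basis (i : 'I_n + 'I_p) : XY :=
  match i with inl k => (delta_mx 0 k, 0) | inr l => (0, delta_mx l 0) end.

Definition xy_coord (w : XY) (i : 'I_n + 'I_p) : R :=
  match i with inl k => w.1 0 k | inr l => w.2 l 0 end.

Definition xyc_basis (i : 'I_n + 'I_p + 'I_p) : XYC :=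
  match i with inl k => (xy_basis k, 0) | inr l => (0, delta_mx l 0) end.

Definition xyc_coord (w : XYC) (i : 'I_n + 'I_p + 'I_p) : R :=
  match i with inl k => xy_coord w.1 k | inr l => w.2 l 0 end.

Lemma sum_pairl (A B : lmodType R) (I : finType) (c : I -> R) (b : I -> A) :
  \sum_i c i *: ((b i, 0) : A * B) = (\sum_i c i *: b i, 0).
Proof.
rewrite [LHS]surjective_pairing; congr (_, _).
  by rewrite (raddf_sum (@fst _ _)).
by rewrite (raddf_sum (@snd _ _)) big1// => i _; exact: scaler0.
Qed.

Lemma sum_pairr (A B : lmodType R) (I : finType) (c : I -> R) (b : I -> B) :
  \sum_i c i *: ((0, b i) : A * B) = (0, \sum_i c i *: b i).
Proof.
rewrite [LHS]surjective_pairing; congr (_, _).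
  by rewrite (raddf_sum (@fst _ _)) big1// => i _; exact: scaler0.
by rewrite (raddf_sum (@snd _ _)).
Qed.

Lemma sum_cV_delta (c : 'cV[R]_p) : \sum_l c l 0 *: delta_mx l 0 = c.
Proof.
by rewrite [RHS]matrix_sum_delta; apply: eq_bigr => l _; rewrite big_ord1.
Qed.

Lemma xy_basisE w : \sum_i xy_coord w i *: xy_basis i = w.
Proof.
rewrite big_sumType/= sum_pairl sum_pairr sum_cV_delta -row_sum_delta.
by case: w => x y; congr (_, _); rewrite ?addr0 ?add0r.
Qed.

Lemma xyc_basisE w : \sum_i xyc_coord w i *: xyc_basis i = w.
Proof.
rewrite big_sumType/= sum_pairl sum_pairr sum_cV_delta xy_basisE.
by case: w => x y; congr (_, _); rewrite ?addr0 ?add0r.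
Qed.

End coordinates.

Lemma continuous_entry (R : realType) (T : topologicalType) a b
    (f : T -> 'M[R]_(a, b)) i j : continuous f -> continuous (fun x => f x i j).
Proof.
move=> cf x; have cij : continuous (fun A : 'M[R]_(a, b) => A i j : R).
  exact: coord_continuous.
exact: (continuous_comp (cf x) (cij (f x))).
Qed.

Section gauss_green_composition.
Variables (R : realType) (n p : nat).
Local Notation X := 'rV[R]_n.
Local Notation XY := ('rV[R]_n * 'cV[R]_p)%type.
Local Notation XYC := (XY * 'cV[R]_p)%type.
Local Notation lam := (@lebesgue_rV R n).
Variables (Omega : set X) (sigma : {finite_measure set X -> \bar R}) (eta : X -> X).
Hypotheses (cO : compact Omega) (SD : surface_data Omega sigma eta).
Variables (y : X -> 'cV[R]_p) (z : X -> 'M[R]_(p, n)) (M : R).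
Hypothesis cy : continuous y.
Hypothesis mz : forall l m, measurable_fun setT (fun x => z x l m).
Hypothesis zM : forall l m x, `|z x l m| <= M.
Hypothesis yz : forall l m psi, test_function Omega° psi ->
  \int[lam]_x (y x l 0 * 'D_(delta_mx 0 m) (psi : X -> R^o) x) =
  - \int[lam]_x (z x l m * psi x).

(** A common bound for the derivatives of all coordinates: [M] for those of y, and 1 for those of
    x. *)
Let N : R := `|M| + 1.

Let N1 : 1 <= N. Proof. by rewrite lerDr. Qed.

Let MN : M <= N. Proof. by rewrite (le_trans (ler_norm M))// lerDl. Qed.

Let u x := xy_coord (x, y x).
Let g m x := xy_coord (delta_mx 0 m, col m (z x)).

Let cu i : continuous (u ^~ i).
Proof.
case: i => k; first exact: coord_continuous.
exact: continuous_entry.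
Qed.

Let mg m i : measurable_fun setT (fun x => g m x i).
Proof.
case: i => k; rewrite /g/=; first exact: measurable_cst.
by under eq_fun do rewrite mxE; exact: mz.
Qed.

Let gN m i x : `|g m x i| <= N.
Proof.
case: i => k; rewrite /g/= mxE; last exact: le_trans (zM _ _ _) MN.
by apply: le_trans N1; rewrite ger0_norm ?ler0n// lern1; case: (_ && _).
Qed.

Let ug m i psi : test_function Omega° psi ->
  \int[lam]_x (u x i * 'D_(delta_mx 0 m) (psi : X -> R^o) x) =
  - \int[lam]_x (g m x i * psi x).
Proof.
move=> psiT; case: i => k; rewrite /u /g/=.
  rewrite (weak_partial_coord k m psiT); congr (- _).
  by apply: eq_Rintegral => x _; rewrite mxE eqxx.
rewrite yz//; congr (- _).
by apply: eq_Rintegral => x _; rewrite mxE.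
Qed.

Lemma gauss_green_xy (f : XY -> R^o) m : smooth f ->
  \int[sigma]_(x in boundary Omega) (f (x, y x) * eta x 0 m) =
  \int[lam]_(x in Omega) total_derivative f m (x, y x, z x).
Proof.
move=> sf.
have := @gauss_green_chain R n Omega sigma eta cO SD _ _ (@xy_basis R n p)
  (fun i x => u x i) (fun m i x => g m x i) N f cu mg gN ug sf m.
under eq_Rintegral do rewrite xy_basisE.
move=> ->; apply: eq_Rintegral => x _.
by rewrite !xy_basisE total_derivativeE.
Qed.

Variables (c : X -> 'cV[R]_p) (d : 'I_n -> X -> 'cV[R]_p).
Hypothesis cc : continuous c.
Hypothesis md : forall m l, measurable_fun setT (fun x => d m x l 0).
Hypothesis dM : forall m l x, `|d m x l 0| <= M.
Hypothesis cd : forall m l psi, test_function Omega° psi ->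
  \int[lam]_x (c x l 0 * 'D_(delta_mx 0 m) (psi : X -> R^o) x) =
  - \int[lam]_x (d m x l 0 * psi x).

(** For (b), [a l] is [phi] times an entry of B, [c] a column of Dy and [d] the corresponding second
    derivatives. Linearity in [c] makes the chain rule produce exactly the two product rule
    terms. *)
Lemma gauss_green_xyc (a : 'I_p -> XY -> R^o) m : (forall l, smooth (a l)) ->
  \int[sigma]_(x in boundary Omega)
    ((\sum_l a l (x, y x) * c x l 0) * eta x 0 m) =
  \int[lam]_(x in Omega) \sum_l
    (total_derivative (a l) m (x, y x, z x) * c x l 0 + a l (x, y x) * d m x l 0).
Proof.
move=> sa.
pose v x := xyc_coord ((x, y x), c x).
pose h m x := xyc_coord ((delta_mx 0 m, col m (z x)), d m x).
pose f (w : XYC) : R^o := \sum_l a l w.1 * w.2 l 0.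
have cv i : continuous (v ^~ i).
  case: i => k; first exact: cu.
  exact: continuous_entry.
have mh m' i : measurable_fun setT (fun x => h m' x i).
  by case: i => k; [exact: mg|exact: md].
have hN m' i x : `|h m' x i| <= N.
  by case: i => k; [exact: gN|rewrite (le_trans (dM _ _ _))].
have vh m' i psi : test_function Omega° psi ->
    \int[lam]_x (v x i * 'D_(delta_mx 0 m') (psi : X -> R^o) x) =
    - \int[lam]_x (h m' x i * psi x).
  by case: i => k; [exact: ug|exact: cd].
have cfst : continuous (fst : XYC -> XY) by move=> w; exact: cvg_fst.
have sfst l : smooth (fun w : XYC => a l w.1 : R^o).
  exact: (smooth_comp_linear (L := fst) cfst (sa l)).
have lsnd l : linear (fun w : XYC => w.2 l 0 : R^o) by move=> k w w'; rewrite /= !mxE.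
have csnd l : continuous (fun w : XYC => w.2 l 0 : R^o).
  by apply: continuous_entry => w; exact: cvg_snd.
have ssnd l : smooth (fun w : XYC => w.2 l 0 : R^o) by exact: smooth_linear.
have sf : smooth f by apply: smooth_sum => l; exact: smoothM.
have Df (b w : XYC) : 'D_b f w =
    \sum_l ('D_b.1 (a l) w.1 * w.2 l 0 + a l w.1 * b.2 l 0).
  have -> : f = \sum_l (fun w : XYC => a l w.1 * w.2 l 0 : R^o).
    by apply/funext => w'; rewrite fct_sumE.
  rewrite derive_sum => [|l]; last first.
    by apply: diff_derivable; apply: smooth_differentiable; exact: smoothM.
  apply: eq_bigr => l _.
  rewrite (@deriveM _ _ (fun w : XYC => a l w.1 : R^o) (fun w : XYC => w.2 l 0 : R^o));
    try by apply: diff_derivable; exact: smooth_differentiable.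
  rewrite (derive_linear _ _ (lsnd l) (csnd l)) addrC; congr (_ + _).
  by rewrite [LHS]mulrC (derive_comp_linear fst).
have := @gauss_green_chain R n Omega sigma eta cO SD _ _ (@xyc_basis R n p)
  (fun i x => v x i) (fun m i x => h m x i) N f cv mh hN vh sf m.
under eq_Rintegral do rewrite xyc_basisE.
move=> ->; apply: eq_Rintegral => x _.
rewrite !xyc_basisE Df; apply: eq_bigr => l _ /=.
by rewrite total_derivativeE.
Qed.

End gauss_green_composition.

(** * From the divergence theorem along the graph to the identities (a), (b) and (c) *)

Theorem theorem1 (R : realType) (n ny nF nG nOmega nb : nat)
  (* domain *)
  (gOmega : 'I_nOmega -> mpoly.mpoly n R) (Omega : set 'rV[R]_n)
  (OmegaE : Omega = basic_semialgebraic gOmega)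
  (Omega_compact : compact Omega)
  (Omega_regular : closure Omega° = Omega)
  (Omega_lipschitz : lipschitz_boundary Omega)
  (sigma : {finite_measure set 'rV[R]_n -> \bar R})
  (eta : 'rV[R]_n -> 'rV[R]_n)
  (sigma_eta : surface_data Omega sigma eta)
  (* decomposition of the boundary *)
  (bd : 'I_nb -> set 'rV[R]_n)
  (bd_cover : boundary Omega = \bigcup_i bd i)
  (bd_semialgebraic : forall i, exists (N : nat) (g : 'I_N -> mpoly.mpoly n R),
     bd i = basic_semialgebraic g)
  (bd_smooth : forall i, smooth_piece (bd i))
  (bd_disjoint : forall i j, i != j -> sigma (bd i `&` bd j) = 0%E)
  (* data *)
  (F : 'rV[R]_n * 'cV[R]_ny * 'M[R]_(ny, n) -> 'cV[R]_nF)
  (B : 'I_n -> 'I_n -> 'rV[R]_n * 'cV[R]_ny -> 'M[R]_(nF, ny))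
  (G : 'rV[R]_n * 'cV[R]_ny * 'M[R]_(ny, n) -> 'cV[R]_nG)
  (F_poly : forall q, polynomial_in (@jet_coords R n ny) (fun w => F w q 0))
  (B_poly : forall i j : 'I_n, (i <= j)%N -> forall q l,
     polynomial_in (@xy_coords R n ny) (fun w => B i j w q l))
  (G_poly : forall i q, exists2 P,
     polynomial_in (@jet_coords R n ny) P &
     {ae sigma, forall x, bd i x -> forall y z, G (x, y, z) q 0 = P (x, y, z)})
  (k : nat)
  (kE : k = if `[< forall i j : 'I_n, (i <= j)%N -> forall w, B i j w = 0 >]
            then 1%N else 2%N)
  (Y : set 'cV[R]_ny) (Z : set 'M[R]_(ny, n))
  (Y_borel : measurable Y) (Z_borel : measurable Z)
  (* the map y, its Jacobian Dy and its second derivatives D2y *)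
  (y : 'rV[R]_n -> 'cV[R]_ny)
  (Dy : 'rV[R]_n -> 'M[R]_(ny, n))
  (D2y : 'I_n -> 'I_n -> 'rV[R]_n -> 'cV[R]_ny)
  (y_sobolev : forall l, sobolev_infty Omega° k (fun x => y x l 0))
  (y_continuous : {within Omega, continuous y})
  (Dy_weak : forall l m,
     weak_partial Omega° m (fun x => y x l 0) (fun x => Dy x l m) /\
     Linfty Omega° (fun x => Dy x l m))
  (D2y_weak : k = 2%N -> forall l i j,
     weak_partial Omega° j (fun x => Dy x l i) (fun x => D2y i j x l 0) /\
     Linfty Omega° (fun x => D2y i j x l 0))
  (Dy_trace : k = 2%N -> {within Omega, continuous Dy})
  (Dy_boundary : k = 1%N ->
     measurable_fun_completion sigma (boundary Omega) Dy /\
     exists M, forall x, boundary Omega x -> `|Dy x| <= M)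
  (yY : forall x, Omega x -> Y (y x))
  (DyZ : {ae @lebesgue_rV R n, forall x, Omega x -> Z (Dy x)})
  (DyZ_boundary : {ae sigma, forall x, boundary Omega x -> Z (Dy x)})
  (* the boundary value problem *)
  (pde : {ae @lebesgue_rV R n, forall x, Omega° x ->
     F (x, y x, Dy x) +
     \sum_(i < n) \sum_(j < n | (i <= j)%N) B i j (x, y x) *m D2y i j x = 0})
  (bc : {ae sigma, forall x, boundary Omega x -> G (x, y x, Dy x) = 0})
  (* occupation and boundary measures *)
  (mu mub : {measure set ('rV[R]_n * 'cV[R]_ny * 'M[R]_(ny, n)) -> \bar R})
  (muE : is_occupation_measure (@lebesgue_rV R n) Omega y Dy Y Z mu)
  (mubE : is_occupation_measure sigma (boundary Omega) y Dy Y Z mub)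
  (phi : 'rV[R]_n * 'cV[R]_ny -> R^o) (phi_smooth : smooth phi) :
  [/\ forall m,
        \int[mu]_(w in Omega `*` Y `*` Z) total_derivative phi m w -
        \int[mub]_(w in boundary Omega `*` Y `*` Z)
          (phi w.1 * eta w.1.1 0 m) = 0,
      mx_integral mu (Omega `*` Y `*` Z) (fun w => phi w.1 *: F w) -
      \sum_(i < n) \sum_(j < n | (i <= j)%N)
        mx_integral mu (Omega `*` Y `*` Z) (fun w =>
          phi w.1 *: (total_derivative (B i j) j w *m col i w.2)) -
      \sum_(i < n) \sum_(j < n | (i <= j)%N)
        mx_integral mu (Omega `*` Y `*` Z) (fun w =>
          total_derivative phi j w *: (B i j w.1 *m col i w.2)) +
      \sum_(i < n) \sum_(j < n | (i <= j)%N)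
        mx_integral mub (boundary Omega `*` Y `*` Z) (fun w =>
          (phi w.1 * eta w.1.1 0 j) *: (B i j w.1 *m col i w.2)) = 0
    & mx_integral mub (boundary Omega `*` Y `*` Z)
        (fun w => phi w.1 *: G w) = 0].
Proof.
have clO : closed Omega by apply: compact_closed => //; exact: norm_hausdorff.
have mO : measurable Omega by exact: closed_measurable_rV.
have oOi : open Omega° by exact: open_interior.
have mOi : measurable Omega° by exact: open_measurable_rV.
have mB : measurable (boundary Omega) by exact: measurable_boundary.
have BO : boundary Omega `<=` Omega by exact: boundary_subset.
have Ofin : (lebesgue_rV Omega < +oo)%E by exact: lebesgue_compact_lty.
have Bfin : (sigma (boundary Omega) < +oo)%E.
  by rewrite ltey_eq fin_num_measure.
have [yh cyh yhE] := continuous_extension_mx Omega_compact y_continuous.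
have [z0 [M [mz0 z0M z0E]]] := Linfty_regular_fin (u := fun lm : 'I_ny * 'I_n =>
  fun x => Dy x lm.1 lm.2) mOi (fun lm => (Dy_weak lm.1 lm.2).2).
pose z x : 'M[R]_(ny, n) := \matrix_(l, m) z0 (l, m) x.
have mz l m : measurable_fun setT (fun x => z x l m).
  by under eq_fun do rewrite mxE; exact: mz0.
have zM l m x : `|z x l m| <= M by rewrite mxE.
have Dyz_int : {ae @lebesgue_rV R n, forall x, Omega° x -> Dy x = z x}.
  by apply: filterS z0E => x zx Ox; apply/matrixP => l m; rewrite mxE -zx.
have Dyz : {ae @lebesgue_rV R n, forall x, Omega x -> Dy x = z x}.
  exact: (ae_interior Omega_compact sigma_eta Dyz_int).
have yz l m psi : test_function Omega° psi ->
    \int[@lebesgue_rV R n]_x (yh x l 0 * 'D_(delta_mx 0 m) (psi : _ -> R^o) x) =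
    - \int[@lebesgue_rV R n]_x (z x l m * psi x).
  move: psi; apply/(@weak_partial_globalP _ _ Omega° m (fun x => y x l 0) (fun x => Dy x l m)).
  - by move=> x /interior_subset Ox; rewrite yhE.
  - by apply: filterS Dyz_int => x zx Ox; rewrite zx.
  - by case: (Dy_weak l m).
have [etah metah etaE] := completion_regular mB (surface_normal_measurable sigma_eta).
(* For [k = 1] the boundary values of Dy are the fixed sigma-measurable function; for [k = 2] they
   are the trace, contained in the continuity of Dy on Omega. *)
have [zb mzb Dyzb] : exists2 zb, measurable_fun setT zb &
    {ae sigma, forall x, boundary Omega x -> Dy x = zb x}.
  have : k = 1%N \/ k = 2%N by rewrite kE; case: asboolP; [left|right].
  move=> [k1|k2]; first by have [cDy _] := Dy_boundary k1; exact: (completion_regular mB cDy).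
  have [zb czb zbE] := continuous_extension_mx Omega_compact (Dy_trace k2).
  exists zb; last by apply: aeW => x /BO Ox; exact: zbE.
  apply: measurable_fun_mx => l m; apply: continuous_measurable_rV.
  exact: continuous_entry.
have myh : measurable_fun setT yh.
  apply: measurable_fun_mx => l m; apply: continuous_measurable_rV.
  exact: continuous_entry.
have mzz : measurable_fun setT z by apply: measurable_fun_mx.
have transfer (f fh : 'rV[R]_n * 'cV[R]_ny * 'M[R]_(ny, n) -> R) :
    measurable_fun setT fh -> (forall x a b, Omega x -> f (x, a, b) = fh (x, a, b)) ->
    \int[mu]_(w in Omega `*` Y `*` Z) f w =
    \int[@lebesgue_rV R n]_(x in Omega) f (x, yh x, z x).
  move=> mfh ffh.
  rewrite (occupation_Rintegral mO Ofin Y_borel Z_borel myh mzz _ Dyz _ DyZ muE mfh).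
  - apply: ae_eq_Rintegral_nomeas; apply: filterS Dyz => x zx Ox.
    by rewrite yhE// zx.
  - by apply: aeW => x Ox; rewrite yhE.
  - by apply: aeW => x Ox; exact: yY.
  - by apply: aeW => x Ox a b; exact: ffh.
(* Unlike in [transfer], Dy is not replaced by [z], which equals it only Lebesgue-almost
   everywhere. *)
have transferb (f fh : 'rV[R]_n * 'cV[R]_ny * 'M[R]_(ny, n) -> R) :
    measurable_fun setT fh ->
    {ae sigma, forall x, boundary Omega x -> forall a b, f (x, a, b) = fh (x, a, b)} ->
    \int[mub]_(w in boundary Omega `*` Y `*` Z) f w =
    \int[sigma]_(x in boundary Omega) f (x, yh x, Dy x).
  move=> mfh ffh.
  rewrite (occupation_Rintegral mB Bfin Y_borel Z_borel myh mzb _ Dyzb _ DyZ_boundary mubE mfh)//.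
  - by apply: eq_Rintegral => x /set_mem/BO Ox; rewrite yhE.
  - by apply: aeW => x /BO Ox; rewrite yhE.
  - by apply: aeW => x /BO Ox; exact: yY.
have meta m : measurable_fun setT (fun w : 'rV[R]_n * 'cV[R]_ny * 'M[R]_(ny, n) =>
    etah w.1.1 0 m).
  apply: (measurableT_comp (@measurable_coord _ _ _ 0 m)).
  by apply: measurableT_comp => //; exact: measurableT_comp.
split.
- move=> m; rewrite (transfer _ (total_derivative phi m))//; 
    last exact: measurable_total_derivative.
  rewrite (transferb _ (fun w => phi w.1 * etah w.1.1 0 m)); last 2 first.
  + by apply: measurable_funM => //; exact: measurable_smooth_jet.
  + by apply: filterS etaE => x etax Bx a b; rewrite /= etax.
  by rewrite (gauss_green_xy Omega_compact sigma_eta cyh mz zM yz)// subrr.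
- have sB (i j : 'I_n) q l : (i <= j)%N -> smooth (fun w => B i j w q l : R^o).
    by move=> ij; apply: smooth_polynomial_xy; exact: B_poly.
  have TDB (i j : 'I_n) q l w : (i <= j)%N -> total_derivative (B i j) j w q l =
      total_derivative (fun v => B i j v q l : R^o) j w.
    by move=> ij; apply: total_derivative_entry => a b; exact: sB.
  have lsmooth (f : 'rV[R]_n * 'cV[R]_ny -> R^o) : smooth f ->
      locally_bounded_measurable (fun x => f (x, yh x)).
    move=> sf; apply: lbm_continuous => x.
    exact: (continuous_comp (cvg_pair cvg_id (cyh x)) (smooth_continuous sf (x := (x, yh x)))).
  have lz l m : locally_bounded_measurable (fun x => z x l m).
    exact: (lbm_bounded (mz l m) (zM l m)).
  have lTD (f : 'rV[R]_n * 'cV[R]_ny -> R^o) m : smooth f ->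
      locally_bounded_measurable (fun x => total_derivative f m (x, yh x, z x)).
    by move=> sf; exact: lbm_total_derivative sf cyh mz zM.
  apply/matrixP => q r; rewrite ord1 {r}.
  pose T2 i j := \int[mu]_(w in Omega `*` Y `*` Z)
    (phi w.1 *: (total_derivative (B i j) j w *m col i w.2)) q 0.
  pose T3 i j := \int[mu]_(w in Omega `*` Y `*` Z)
    (total_derivative phi j w *: (B i j w.1 *m col i w.2)) q 0.
  pose T4 i j := \int[mub]_(w in boundary Omega `*` Y `*` Z)
    ((phi w.1 * eta w.1.1 0 j) *: (B i j w.1 *m col i w.2)) q 0.
  (* [s i j] is a Borel version of [phi] times the second order term; the last clause is the
     divergence theorem for one pair (i, j). *)
  have [s sE] : exists s : 'I_n -> 'I_n -> 'rV[R]_n -> R, forall i j : 'I_n, (i <= j)%N ->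
      [/\ locally_bounded_measurable (s i j),
        {ae @lebesgue_rV R n, forall x, Omega x ->
          phi (x, yh x) * (B i j (x, yh x) *m D2y i j x) q 0 = s i j x}
      & T4 i j = T2 i j + T3 i j + \int[@lebesgue_rV R n]_(x in Omega) s i j x].
    suff H (i j : 'I_n) : exists s : 'rV[R]_n -> R, (i <= j)%N ->
        [/\ locally_bounded_measurable s,
          {ae @lebesgue_rV R n, forall x, Omega x ->
            phi (x, yh x) * (B i j (x, yh x) *m D2y i j x) q 0 = s x}
        & T4 i j = T2 i j + T3 i j + \int[@lebesgue_rV R n]_(x in Omega) s x].
      exists (fun i j => projT1 (cid (H i j))) => i j ij.
      by case: (cid (H i j)) => s /= /(_ ij).
    (* If the relevant B vanish, so do all the terms; otherwise [k = 2] supplies a continuous Dy and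
       its weak derivatives. *)
    have [B0|k2] : (forall i j : 'I_n, (i <= j)%N -> forall w, B i j w = 0) \/ k = 2%N.
      by rewrite kE; case: asboolP; [left|right].
      exists (cst 0) => ij; have Bij : B i j = cst 0 by apply/funext => w; exact: B0.
      split; first exact: lbm_cst.
        by apply: aeW => x _; rewrite Bij mul0mx mxE mulr0.
      have TD0 w : total_derivative (B i j) j w = 0.
        rewrite Bij /total_derivative derive_cst add0r big1// => l _.
        by rewrite derive_cst scaler0.
      rewrite /T2 /T3 /T4 Bij.
      under eq_Rintegral do rewrite mul0mx scaler0 mxE.
      under [X in X + _ + _]eq_Rintegral do rewrite -Bij TD0 mul0mx scaler0 mxE.
      under [X in _ + X + _]eq_Rintegral do rewrite mul0mx scaler0 mxE.
      have int0 d (T : measurableType d) (nu : {measure set T -> \bar R}) D :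
          \int[nu]_(x in D) (0 : R) = 0 by rewrite /Rintegral integral0.
      by rewrite !int0 !addr0.
    (* Two versions of Dy coexist: the bounded Borel [z], as the derivative of y, and the continuous
       [ze], as the function to be differentiated. They agree almost everywhere on Omega. *)
    have [ze cze zeE] := continuous_extension_mx Omega_compact (Dy_trace k2).
    have [d0 [M' [md0 d0M d0E]]] := Linfty_regular_fin (u := fun ml : 'I_n * 'I_ny =>
      fun x => D2y i ml.1 x ml.2 0) mOi (fun ml => (D2y_weak k2 ml.2 i ml.1).2).
    pose c x := col i (ze x).
    pose d m x : 'cV[R]_ny := \col_l d0 (m, l) x.
    have md m l : measurable_fun setT (fun x => d m x l 0).
      by under eq_fun do rewrite mxE; exact: md0.
    have zN l m x : `|z x l m| <= `|M| + `|M'|.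
      by rewrite (le_trans (zM l m x))// (le_trans (ler_norm M))// lerDl.
    have dN m l x : `|d m x l 0| <= `|M| + `|M'|.
      by rewrite mxE (le_trans (d0M _ x))// (le_trans (ler_norm M'))// lerDr.
    have cc : continuous c.
      apply: continuous_mx => l m; under eq_fun do rewrite mxE.
      exact: continuous_entry.
    have cd m l psi : test_function Omega° psi ->
        \int[@lebesgue_rV R n]_x (c x l 0 * 'D_(delta_mx 0 m) (psi : _ -> R^o) x) =
        - \int[@lebesgue_rV R n]_x (d m x l 0 * psi x).
      move: psi; apply/(@weak_partial_globalP _ _ Omega° m (fun x => Dy x l i)
        (fun x => D2y i m x l 0)).
      - by move=> x /interior_subset Ox; rewrite mxE zeE.
      - by apply: filterS d0E => x dx Ox; rewrite mxE -(dx Ox (m, l)).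
      - by case: (D2y_weak k2 l i m).
    exists (fun x => phi (x, yh x) * \sum_l B i j (x, yh x) q l * d j x l 0) => ij.
    have ld m l : locally_bounded_measurable (fun x => d m x l 0).
      exact: (lbm_bounded (md m l) (dN m l)).
    have lphi := lsmooth _ phi_smooth.
    have lB l := lsmooth _ (sB i j q l ij).
    have lTDB l := lTD _ j (sB i j q l ij).
    have lTDphi := lTD _ j phi_smooth.
    pose t2 x := phi (x, yh x) *
      \sum_l total_derivative (fun v => B i j v q l : R^o) j (x, yh x, z x) * z x l i.
    pose t3 x := total_derivative phi j (x, yh x, z x) *
      \sum_l B i j (x, yh x) q l * z x l i.
    have ls : locally_bounded_measurable
        (fun x => phi (x, yh x) * \sum_l B i j (x, yh x) q l * d j x l 0).
      by apply: lbmM => //; apply: lbm_sum => l _; exact: lbmM.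
    have lt2 : locally_bounded_measurable t2.
      by apply: lbmM => //; apply: lbm_sum => l _; exact: lbmM.
    have lt3 : locally_bounded_measurable t3.
      by apply: lbmM => //; apply: lbm_sum => l _; exact: lbmM.
    split=> //.
      have : {ae @lebesgue_rV R n, forall x, Omega x ->
          forall l, D2y i j x l 0 = d j x l 0}.
        apply: (ae_interior Omega_compact sigma_eta).
        by apply: filterS d0E => x dx Ox l; rewrite mxE -(dx Ox (j, l)).
      apply: filterS => x dx Ox; rewrite mxE; congr (_ * _).
      by apply: eq_bigr => l _; rewrite dx.
    have -> : T2 i j = \int[@lebesgue_rV R n]_(x in Omega) t2 x.
      rewrite /T2 (transfer _ (fun w => phi w.1 *
        \sum_l total_derivative (fun v => B i j v q l : R^o) j w * w.2 l i)).
      - apply: eq_Rintegral => x _; rewrite !mxE; congr (_ * _).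
        by apply: eq_bigr => l _; rewrite TDB// mxE.
      - apply: measurable_funM; first exact: measurable_smooth_jet.
        apply: measurable_sum => l; apply: measurable_funM.
          by apply: measurable_total_derivative; exact: sB.
        exact: measurable_jet_entry.
      - move=> x a b _; rewrite !mxE; congr (_ * _).
        by apply: eq_bigr => l _; rewrite TDB// mxE.
    have -> : T3 i j = \int[@lebesgue_rV R n]_(x in Omega) t3 x.
      rewrite /T3 (transfer _ (fun w => total_derivative phi j w *
        \sum_l B i j w.1 q l * w.2 l i)).
      - apply: eq_Rintegral => x _; rewrite !mxE; congr (_ * _).
        by apply: eq_bigr => l _; rewrite mxE.
      - apply: measurable_funM; first exact: measurable_total_derivative.
        apply: measurable_sum => l; apply: measurable_funM.
          by apply: (measurable_smooth_jet (f := fun v => B i j v q l)); exact: sB.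
        exact: measurable_jet_entry.
      - move=> x a b _; rewrite !mxE; congr (_ * _).
        by apply: eq_bigr => l _; rewrite mxE.
    have -> : T4 i j = \int[sigma]_(x in boundary Omega)
        ((\sum_l (phi (x, yh x) * B i j (x, yh x) q l) * c x l 0) * eta x 0 j).
      rewrite /T4 (transferb _ (fun w => phi w.1 * etah w.1.1 0 j *
        \sum_l B i j w.1 q l * w.2 l i)).
      - apply: eq_Rintegral => x /set_mem/BO Ox; rewrite !mxE mulr_sumr mulr_suml.
        by apply: eq_bigr => l _; rewrite !mxE zeE//=; ring.
      - apply: measurable_funM.
          by apply: measurable_funM => //; exact: measurable_smooth_jet.
        apply: measurable_sum => l; apply: measurable_funM.
          by apply: (measurable_smooth_jet (f := fun v => B i j v q l)); exact: sB.
        exact: measurable_jet_entry.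
      - apply: filterS etaE => x etax Bx a b; rewrite !mxE etax//; congr (_ * _).
        by apply: eq_bigr => l _; rewrite mxE.
    have sphiB l : smooth (fun w => phi w * B i j w q l : R^o).
      by apply: smoothM => //; exact: sB.
    rewrite (gauss_green_xyc Omega_compact sigma_eta cyh mz zN yz cc md dN cd j sphiB).
    rewrite -!RintegralD//; try by apply: lbm_integrable_compact => //; exact: lbmD.
    apply: ae_eq_Rintegral_nomeas; apply: filterS Dyz => x zx Ox.
    rewrite /t2 /t3 !mulr_sumr -!big_split/=; apply: eq_bigr => l _.
    rewrite total_derivativeM//=; last exact: sB.
    by rewrite mxE -zeE// zx//; ring.
  have sumE (A : 'I_n -> 'I_n -> 'cV[R]_nF) :
      (\sum_(i < n) \sum_(j < n | (i <= j)%N) A i j) q 0 =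
      \sum_(i < n) \sum_(j < n | (i <= j)%N) A i j q 0.
    by rewrite summxE; apply: eq_bigr => i _; rewrite summxE.
  have entryE d (T : measurableType d) (nu : {measure set T -> \bar R}) D
      (f : T -> 'cV[R]_nF) : mx_integral nu D f q 0 = \int[nu]_(w in D) f w q 0.
    by rewrite mxE.
  have lsum (i : 'I_n) : locally_bounded_measurable (fun x => \sum_(j < n | (i <= j)%N) s i j x).
    by apply: lbm_sum => j ij; have [] := sE i j ij.
  rewrite [RHS]mxE [LHS]mxE [X in X + _]mxE [X in X + _ + _]mxE.
  rewrite [X in _ + X + _ + _]mxE [X in _ + _ + X + _]mxE !sumE entryE.
  under [X in _ - X - _ + _]eq_bigr do under eq_bigr do rewrite entryE -/(T2 _ _).
  under [X in _ - _ - X + _]eq_bigr do under eq_bigr do rewrite entryE -/(T3 _ _).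
  under [X in _ - _ - _ + X]eq_bigr do under eq_bigr do rewrite entryE -/(T4 _ _).
  under [X in _ - _ - _ + X]eq_bigr => i _.
    under eq_bigr => j ij do (have [_ _ ->] := sE i j ij).
    rewrite !big_split/=; over.
  rewrite !big_split/=.
  have mF : measurable_fun setT (fun w => phi w.1 * F w q 0).
    apply: measurable_funM; first exact: measurable_smooth_jet.
    exact: measurable_polynomial_jet.
  rewrite (transfer _ (fun w => phi w.1 * F w q 0)) => [| |x a b _]//; last by rewrite mxE.
  (* The differential equation, valid almost everywhere on Omega because the boundary is null,
     exchanges [phi] F for minus the sum of the [s i j]. *)
  rewrite [X in X - _ - _ + _](_ : _ = - \int[@lebesgue_rV R n]_(x in Omega)
      (\sum_(i < n) \sum_(j < n | (i <= j)%N) s i j x)); last first.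
    rewrite -[RHS]mulN1r -RintegralZl//; last first.
      by apply: lbm_integrable_compact => //; apply: lbm_sum => i _; exact: lsum.
    have sae : {ae @lebesgue_rV R n, forall x (i j : 'I_n), (i <= j)%N -> Omega x ->
        phi (x, yh x) * (B i j (x, yh x) *m D2y i j x) q 0 = s i j x}.
      apply: filter_forall => i; apply: filter_forall => j.
      have [ij|ij] := boolP (i <= j)%N; last by apply: aeW.
      by have [_ + _] := sE i j ij; apply: filterS => x sx _; exact: sx.
    have pdeO := ae_interior Omega_compact sigma_eta pde.
    apply: ae_eq_Rintegral_nomeas.
    apply: filterS (filterI (filterI sae Dyz) pdeO) => x [[sx zx] pdex] Ox.
    have /matrixP/(_ q 0) := pdex Ox; rewrite yhE// zx// !mxE sumE => /eqP.
    rewrite addr_eq0 => /eqP ->; rewrite mulrN mulN1r mulr_sumr; congr (- _).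
    apply: eq_bigr => i _; rewrite mulr_sumr; apply: eq_bigr => j ij.
    exact: sx.
  rewrite Rintegral_sum//; last first.
    by move=> i _; apply: lbm_integrable_compact => //; exact: lsum.
  under [\sum_i \int[_]_(_ in _) _]eq_bigr => i _.
    rewrite Rintegral_sum//; last first.
      by move=> j ij; apply: lbm_integrable_compact => //; case: (sE i j ij).
    over.
  (* The sums of [T2], [T3] and the integrals of [s] contained in the boundary terms cancel the
     three interior contributions. *)
  by ring.
- apply/matrixP => q r; rewrite ord1 !mxE.
  have mbd i : measurable (bd i).
    by have [N [g ->]] := bd_semialgebraic i; exact: measurable_basic_semialgebraic.
  have [Gh mGh GhE] : exists2 Gh : 'rV[R]_n * 'cV[R]_ny * 'M[R]_(ny, n) -> R,
      measurable_fun setT Gh & {ae sigma, forall x, boundary Omega x ->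
        forall a b, G (x, a, b) q 0 = Gh (x, a, b)}.
    rewrite bd_cover; apply: (piecewise_measurable (G := fun w => G w q 0) mbd) => i.
    have [P polyP PE] := G_poly i q; exists P => //.
    exact: measurable_polynomial_jet.
  rewrite (transferb _ (fun w => phi w.1 * Gh w)); last 2 first.
  + by apply: measurable_funM => //; exact: measurable_smooth_jet.
  + by apply: filterS GhE => x GhE Bx a b; rewrite mxE GhE.
  rewrite (ae_eq_Rintegral_nomeas (g := cst 0)); first by rewrite Rintegral_cst// mul0r.
  apply: filterS bc => x bcx Bx; rewrite mxE -yhE; last exact: BO.
  by rewrite bcx// mxE mulr0.
Qed.
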